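(* Let $n\ge2$, $d\ge 2$ an even integer, and $f$ a form of degree $d$ in $n$ variables. Then $H_f(x)$ is positive definite for all $x\ne 0$ if and only if there exist a real number $c>0$ and a nonnegative integer $r$ such that the form $f(x)-c\left(\sum_{i=1}^n x_i^2\right)^{d/2}$ is $r$-sos-convex.
   Context: $H_f(x)$ is the Hessian matrix of $f$ at $x$. A polynomial is a sum of squares if it equals $\sum_i q_i^2$ for polynomials $q_i$. For a nonnegative integer $r$, a polynomial $g$ in $x=(x_1,\dots,x_n)$ is called $r$-sos-convex if the polynomial $y^TH_g(x)y\cdot\left(\sum_{i=1}^n x_i^2\right)^r$ in the variables $(x,y)\in\mathbb{R}^{2n}$ is a sum of squares. *)

(* Defs.v *)
From Stdlib Require Import Reals Lra Lia List Arith.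
Open Scope R_scope.

Inductive mpoly : Type :=
| PVar : nat -> mpoly
| PConst : R -> mpoly
| PAdd : mpoly -> mpoly -> mpoly
| PMul : mpoly -> mpoly -> mpoly.

Fixpoint vars_lt (n : nat) (p : mpoly) : Prop :=
  match p with
  | PVar i => (i < n)%nat
  | PConst _ => True
  | PAdd p q => vars_lt n p /\ vars_lt n q
  | PMul p q => vars_lt n p /\ vars_lt n q
  end.

Fixpoint peval (x : nat -> R) (p : mpoly) : R :=
  match p with
  | PVar i => x i
  | PConst c => c
  | PAdd p q => peval x p + peval x q
  | PMul p q => peval x p * peval x q
  end.

Fixpoint pderiv (i : nat) (p : mpoly) : mpoly :=
  match p with
  | PVar j => if Nat.eqb i j then PConst 1 else PConst 0
  | PConst _ => PConst 0
  | PAdd p q => PAdd (pderiv i p) (pderiv i q)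
  | PMul p q => PAdd (PMul (pderiv i p) q) (PMul p (pderiv i q))
  end.

Fixpoint ppow (p : mpoly) (k : nat) : mpoly :=
  match k with
  | O => PConst 1
  | S k => PMul p (ppow p k)
  end.

Definition psum (n : nat) (F : nat -> mpoly) : mpoly :=
  fold_right PAdd (PConst 0) (map F (seq 0 n)).
Definition rsum (n : nat) (F : nat -> R) : R :=
  fold_right Rplus 0 (map F (seq 0 n)).

Definition is_form (n d : nat) (f : mpoly) : Prop :=
  vars_lt n f /\
  forall (t : R) (x : nat -> R), peval (fun i => t * x i) f = t ^ d * peval x f.

Definition nonzero_vec (n : nat) (x : nat -> R) : Prop :=
  exists i, (i < n)%nat /\ x i <> 0.

Definition hessian_pd (n : nat) (f : mpoly) (x : nat -> R) : Prop :=
  forall y : nat -> R, nonzero_vec n y ->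
    0 < rsum n (fun i => rsum n (fun j =>
          y i * y j * peval x (pderiv j (pderiv i f)))).

Definition sumsq (n : nat) : mpoly := psum n (fun i => PMul (PVar i) (PVar i)).

(* y^T H_g(x) y as a polynomial in the 2n variables (x,y), with
   x_i = X_i and y_i = X_{n+i} *)
Definition hess_form (n : nat) (g : mpoly) : mpoly :=
  psum n (fun i => psum n (fun j =>
    PMul (PMul (PVar (n + i)) (PVar (n + j))) (pderiv j (pderiv i g)))).

(* p (in variables X_0..X_{m-1}) is a sum of squares of polynomials in the
   same variables. Equality of real polynomials is checked as equality of
   polynomial functions, which is equivalent over R. *)
Definition is_sos (m : nat) (p : mpoly) : Prop :=
  exists qs : list mpoly, Forall (vars_lt m) qs /\
    forall z : nat -> R,
      peval z p = fold_right Rplus 0 (map (fun q => peval z q ^ 2) qs).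

Definition r_sos_convex (n r : nat) (g : mpoly) : Prop :=
  is_sos (n + n) (PMul (hess_form n g) (ppow (sumsq n) r)).

(* Main.v *)
(* By compactness [y^T H_f(x) y >= delta |x|^(d-2) |y|^2], so [c |x|^d] may be
   subtracted for a small [c].  The Hessian form [P(x,y)] of the difference is then
   multiplied by a power of [|x|^2] as in Polya's theorem.  With [t^2 = |x|^2], the
   functions [u_i = 2|x|^2 + 2 t x_i] and [v_i = 2|x|^2 - 2 t x_i] are sums of squares
   of polynomials in [x, t], have sum [s = 4 n |x|^2], and [u - v = 4 t x].  Corrected by
   a multiple of [1/n^2 - |u - v|^2 / s^2], the form [P((u - v)/s, y)] becomes positive
   definite in [y] on the whole simplex; the coefficients of [s^M P((u - v)/s, y)] as a
   form in [u, v] are, up to positive multinomial factors, quadratic forms in [y] that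
   converge uniformly to its values, hence are positive definite for large [M] and so sums
   of squares of linear forms.  This writes [|x|^(2r) P(x,y)] as a sum of squares
   [(a + t b)^2], and averaging over the two signs of [t] eliminates [t]. *)
Require Import Defs.
From Stdlib Require Import Reals Arith.
From Stdlib Require Import Lra Lia List FunctionalExtensionality ClassicalEpsilon.
From Coquelicot Require Compactness.
Import ListNotations.
Open Scope R_scope.

(** * Finite sums *)

Definition lsum (l : list R) : R := fold_right Rplus 0 l.

Lemma lsum_app l l' : lsum (l ++ l') = lsum l + lsum l'.
Proof. induction l; simpl; [ring|]. unfold lsum in *; simpl; rewrite IHl; ring. Qed.

Lemma lsum_map_ext {A} (f g : A -> R) l :
  (forall a, In a l -> f a = g a) -> lsum (map f l) = lsum (map g l).
Proof. intros H; f_equal; now apply map_ext_in. Qed.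

Lemma lsum_scal {A} c (f : A -> R) l :
  lsum (map (fun a => c * f a) l) = c * lsum (map f l).
Proof. induction l; unfold lsum in *; simpl; [ring|]. rewrite IHl; ring. Qed.

Lemma lsum_ge0 {A} (f : A -> R) l :
  (forall a, 0 <= f a) -> 0 <= lsum (map f l).
Proof.
  intros H; induction l as [|a l IH]; unfold lsum in *; simpl; [lra|].
  specialize (H a); lra.
Qed.

Lemma rsum_S n F : rsum (S n) F = rsum n F + F n.
Proof.
  unfold rsum. rewrite seq_S, map_app. fold (lsum (map F (seq 0 n) ++ map F [0 + n]%nat)).
  rewrite lsum_app. unfold lsum; simpl; ring.
Qed.

Lemma rsum_0 F : rsum 0 F = 0.
Proof. reflexivity. Qed.

Lemma rsum_ext n F G : (forall i, (i < n)%nat -> F i = G i) -> rsum n F = rsum n G.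
Proof.
  induction n; intros H; [reflexivity|].
  rewrite !rsum_S, H by lia. f_equal. apply IHn; intros; apply H; lia.
Qed.

Lemma rsum_le n F G : (forall i, (i < n)%nat -> F i <= G i) -> rsum n F <= rsum n G.
Proof.
  induction n; intros H; [rewrite !rsum_0; lra|].
  rewrite !rsum_S. apply Rplus_le_compat; [apply IHn; intros|]; apply H; lia.
Qed.

Lemma rsum_plus n F G : rsum n (fun i => F i + G i) = rsum n F + rsum n G.
Proof. induction n; [rewrite !rsum_0; ring|]. rewrite !rsum_S, IHn; ring. Qed.

Lemma rsum_minus n F G : rsum n (fun i => F i - G i) = rsum n F - rsum n G.
Proof. induction n; [rewrite !rsum_0; ring|]. rewrite !rsum_S, IHn; ring. Qed.

Lemma rsum_scal n c F : rsum n (fun i => c * F i) = c * rsum n F.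
Proof. induction n; [rewrite !rsum_0; ring|]. rewrite !rsum_S, IHn; ring. Qed.

Lemma rsum_const n c : rsum n (fun _ => c) = INR n * c.
Proof. induction n; [rewrite !rsum_0; simpl; ring|]. rewrite rsum_S, IHn, S_INR; ring. Qed.

Lemma rsum_app n m F : rsum (n + m) F = rsum n F + rsum m (fun i => F (n + i)%nat).
Proof.
  induction m; [rewrite Nat.add_0_r, rsum_0; ring|].
  rewrite Nat.add_succ_r, !rsum_S, IHm; ring.
Qed.

Lemma rsum_ge0 n F : (forall i, (i < n)%nat -> 0 <= F i) -> 0 <= rsum n F.
Proof.
  intros H. replace 0 with (rsum n (fun _ => 0)) by (rewrite rsum_const; ring).
  now apply rsum_le.
Qed.

Lemma rsum_abs n F : Rabs (rsum n F) <= rsum n (fun i => Rabs (F i)).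
Proof.
  induction n; [rewrite !rsum_0, Rabs_R0; lra|].
  rewrite !rsum_S. eapply Rle_trans; [apply Rabs_triang|]. lra.
Qed.

Lemma rsum_term_le n F i :
  (forall i, (i < n)%nat -> 0 <= F i) -> (i < n)%nat -> F i <= rsum n F.
Proof.
  induction n; intros H Hi; [lia|]. rewrite rsum_S.
  destruct (Nat.eq_dec i n) as [->|Hne].
  - assert (0 <= rsum n F) by (apply rsum_ge0; intros; apply H; lia). lra.
  - assert (F i <= rsum n F) by (apply IHn; [intros; apply H|]; lia).
    assert (0 <= F n) by (apply H; lia). lra.
Qed.

Lemma rsum_single n i F :
  (i < n)%nat -> rsum n (fun j => if Nat.eqb j i then F j else 0) = F i.
Proof.
  induction n; intros Hi; [lia|]. rewrite rsum_S.
  destruct (Nat.eqb_spec n i) as [<-|Hne].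
  - rewrite (rsum_ext n _ (fun _ => 0)).
    + rewrite rsum_const; ring.
    + intros j Hj. destruct (Nat.eqb_spec j n); [lia|reflexivity].
  - rewrite IHn by lia; ring.
Qed.

Lemma rsum_seq n F : rsum n F = lsum (map F (seq 0 n)).
Proof. reflexivity. Qed.

(** * Polynomial expressions *)

Lemma peval_ext n p x x' :
  vars_lt n p -> (forall i, (i < n)%nat -> x i = x' i) -> peval x p = peval x' p.
Proof.
  intros Hp H; induction p; simpl in *; auto; destruct Hp;
    rewrite IHp1, IHp2; auto.
Qed.

Lemma vars_lt_mono n m p : (n <= m)%nat -> vars_lt n p -> vars_lt m p.
Proof. intros H; induction p; simpl; auto; [lia|tauto|tauto]. Qed.

Lemma vars_lt_pderiv n i p : vars_lt n p -> vars_lt n (pderiv i p).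
Proof.
  induction p; simpl; auto; [|tauto|tauto].
  intros _; destruct (Nat.eqb i n0); exact I.
Qed.

Lemma vars_lt_ppow n p k : vars_lt n p -> vars_lt n (ppow p k).
Proof. intros H; induction k; simpl; auto. Qed.

Lemma vars_lt_psum m n F :
  (forall i, (i < n)%nat -> vars_lt m (F i)) -> vars_lt m (psum n F).
Proof.
  intros H. unfold psum.
  assert (G : forall i, In i (seq 0 n) -> vars_lt m (F i)).
  { intros i Hi. apply in_seq in Hi. apply H; lia. }
  induction (seq 0 n) as [|a l IH]; simpl; [exact I|].
  split; [apply G; now left|apply IH; intros; apply G; now right].
Qed.

Lemma peval_psum x n F : peval x (psum n F) = rsum n (fun i => peval x (F i)).
Proof. unfold psum, rsum. induction (seq 0 n); simpl; congruence. Qed.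

Lemma peval_ppow x p k : peval x (ppow p k) = peval x p ^ k.
Proof. induction k; simpl; congruence. Qed.

Definition nrm2 (n : nat) (x : nat -> R) : R := rsum n (fun i => x i * x i).

Lemma peval_sumsq x n : peval x (sumsq n) = nrm2 n x.
Proof. unfold sumsq. now rewrite peval_psum. Qed.

Lemma vars_lt_sumsq n : vars_lt n (sumsq n).
Proof. apply vars_lt_psum; simpl; auto. Qed.

Lemma nrm2_ge0 n x : 0 <= nrm2 n x.
Proof. apply rsum_ge0; intros; nra. Qed.

Lemma nrm2_coord n x i : (i < n)%nat -> x i * x i <= nrm2 n x.
Proof.
  intros Hi. apply (rsum_term_le n (fun i => x i * x i)); auto. intros; nra.
Qed.

Lemma nrm2_pos n x : nonzero_vec n x -> 0 < nrm2 n x.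
Proof.
  intros [i [Hi Hx]]. pose proof (nrm2_coord n x i Hi).
  assert (0 < x i * x i) by nra. lra.
Qed.

Lemma nrm2_pos_inv n x : 0 < nrm2 n x -> nonzero_vec n x.
Proof.
  intros H. destruct (classic (nonzero_vec n x)) as [|Hn]; auto.
  exfalso. replace (nrm2 n x) with 0 in H; [lra|].
  unfold nrm2. rewrite (rsum_ext n _ (fun _ => 0)); [rewrite rsum_const; ring|].
  intros i Hi. destruct (Req_dec (x i) 0) as [->|Hne]; [ring|].
  exfalso; apply Hn; exists i; auto.
Qed.

Lemma nrm2_scal n t x : nrm2 n (fun i => t * x i) = t * t * nrm2 n x.
Proof. unfold nrm2. rewrite <- rsum_scal. apply rsum_ext; intros; ring. Qed.

Fixpoint psubst (sigma : nat -> mpoly) (p : mpoly) : mpoly :=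
  match p with
  | PVar i => sigma i
  | PConst c => PConst c
  | PAdd p q => PAdd (psubst sigma p) (psubst sigma q)
  | PMul p q => PMul (psubst sigma p) (psubst sigma q)
  end.

Lemma peval_psubst x sigma p :
  peval x (psubst sigma p) = peval (fun i => peval x (sigma i)) p.
Proof. induction p; simpl; congruence. Qed.

Lemma vars_lt_psubst n m sigma p :
  vars_lt n p -> (forall i, (i < n)%nat -> vars_lt m (sigma i)) ->
  vars_lt m (psubst sigma p).
Proof. intros Hp H; induction p; simpl in *; auto; tauto. Qed.

(** Induction on the expression. One constant [L] bounds both the values and the Lipschitz ratio,
    which lets the product case close with [2 * L1 * L2]. *)
Lemma peval_lipschitz n p : vars_lt n p -> forall B, 0 <= B ->
  exists L, 0 <= L /\ forall x x' eta, 0 <= eta ->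
    (forall i, (i < n)%nat -> Rabs (x i) <= B) ->
    (forall i, (i < n)%nat -> Rabs (x' i) <= B) ->
    (forall i, (i < n)%nat -> Rabs (x i - x' i) <= eta) ->
    Rabs (peval x p) <= L /\ Rabs (peval x' p) <= L /\
    Rabs (peval x p - peval x' p) <= L * eta.
Proof.
  intros Hp B HB; induction p as [i|c|p IHp q IHq|p IHp q IHq]; simpl in *.
  - exists (Rmax B 1). pose proof (Rmax_l B 1); pose proof (Rmax_r B 1).
    split; [lra|]. intros x x' eta He Hx Hx' Hd.
    specialize (Hx i Hp); specialize (Hx' i Hp); specialize (Hd i Hp).
    repeat split; try lra. nra.
  - exists (Rabs c). pose proof (Rabs_pos c). split; [lra|]. intros.
    repeat split; try lra. rewrite Rminus_diag, Rabs_R0. nra.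
  - destruct Hp as [Hp Hq]. destruct (IHp Hp) as [L1 [H1 G1]].
    destruct (IHq Hq) as [L2 [H2 G2]]. exists (L1 + L2). split; [lra|].
    intros x x' eta He Hx Hx' Hd.
    destruct (G1 x x' eta He Hx Hx' Hd) as [A1 [B1 C1]].
    destruct (G2 x x' eta He Hx Hx' Hd) as [A2 [B2 C2]].
    repeat split.
    + eapply Rle_trans; [apply Rabs_triang|lra].
    + eapply Rle_trans; [apply Rabs_triang|lra].
    + replace (_ - _) with ((peval x p - peval x' p) + (peval x q - peval x' q)) by ring.
      eapply Rle_trans; [apply Rabs_triang|lra].
  - destruct Hp as [Hp Hq]. destruct (IHp Hp) as [L1 [H1 G1]].
    destruct (IHq Hq) as [L2 [H2 G2]]. exists (2 * L1 * L2). split; [nra|].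
    intros x x' eta He Hx Hx' Hd.
    destruct (G1 x x' eta He Hx Hx' Hd) as [A1 [B1 C1]].
    destruct (G2 x x' eta He Hx Hx' Hd) as [A2 [B2 C2]].
    pose proof (Rabs_pos (peval x p)). pose proof (Rabs_pos (peval x q)).
    pose proof (Rabs_pos (peval x' p)). pose proof (Rabs_pos (peval x' q)).
    pose proof (Rabs_pos (peval x p - peval x' p)).
    pose proof (Rabs_pos (peval x q - peval x' q)).
    repeat split.
    + rewrite Rabs_mult.
      assert (Rabs (peval x p) * Rabs (peval x q) <= L1 * L2) by (apply Rmult_le_compat; lra).
      nra.
    + rewrite Rabs_mult.
      assert (Rabs (peval x' p) * Rabs (peval x' q) <= L1 * L2) by (apply Rmult_le_compat; lra).
      nra.
    + replace (_ - _) with ((peval x p - peval x' p) * peval x q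
                            + peval x' p * (peval x q - peval x' q)) by ring.
      eapply Rle_trans; [apply Rabs_triang|]. rewrite !Rabs_mult.
      assert (Rabs (peval x p - peval x' p) * Rabs (peval x q) <= (L1 * eta) * L2)
        by (apply Rmult_le_compat; lra).
      assert (Rabs (peval x' p) * Rabs (peval x q - peval x' q) <= L1 * (L2 * eta))
        by (apply Rmult_le_compat; lra).
      lra.
Qed.

(** * Coefficients of the powers of the sum of the variables *)

Definition inc (i : nat) (nu : nat -> nat) : nat -> nat :=
  fun j => if Nat.eqb j i then S (nu j) else nu j.
Definition dec (i : nat) (nu : nat -> nat) : nat -> nat :=
  fun j => if Nat.eqb j i then pred (nu j) else nu j.

(* [word_sum k M phi w] is the sum of [M!/nu! * phi nu * w^nu] over the multi-indices
   [nu] of weight [M] in [k] variables, organised as a sum over words. *)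
Fixpoint word_sum (k M : nat) (phi : (nat -> nat) -> R) (w : nat -> R) : R :=
  match M with
  | O => phi (fun _ => O)
  | S M => rsum k (fun i => w i * word_sum k M (fun nu => phi (inc i nu)) w)
  end.

(** The weight is compared in [R], so that the lemmas on [rsum] apply to it. *)
Definition weight (k : nat) (nu : nat -> nat) (M : nat) : Prop :=
  rsum k (fun i => INR (nu i)) = INR M.

Lemma word_sum_ext k M phi psi w w' :
  (forall nu, phi nu = psi nu) -> (forall i, (i < k)%nat -> w i = w' i) ->
  word_sum k M phi w = word_sum k M psi w'.
Proof.
  intros H Hw; revert phi psi H; induction M; intros; simpl; [apply H|].
  apply rsum_ext; intros. rewrite Hw by auto. f_equal. apply IHM; auto.
Qed.

Lemma word_sum_scal k M c phi w : word_sum k M (fun nu => c * phi nu) w = c * word_sum k M phi w.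
Proof.
  revert phi; induction M; intros; simpl; [reflexivity|].
  rewrite <- rsum_scal. apply rsum_ext; intros. rewrite IHM; ring.
Qed.

Lemma word_sum_plus k M phi psi w :
  word_sum k M (fun nu => phi nu + psi nu) w = word_sum k M phi w + word_sum k M psi w.
Proof.
  revert phi psi; induction M; intros; simpl; [reflexivity|].
  rewrite <- rsum_plus. apply rsum_ext; intros. rewrite IHM; ring.
Qed.

Lemma word_sum_rsum k M n (phi : nat -> (nat -> nat) -> R) w :
  word_sum k M (fun nu => rsum n (fun i => phi i nu)) w = rsum n (fun i => word_sum k M (phi i) w).
Proof.
  induction n.
  - rewrite rsum_0. rewrite (word_sum_ext k M _ (fun nu => 0 * 0) w w); auto.
    + rewrite word_sum_scal; ring.
    + intros; rewrite rsum_0; ring.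
  - rewrite rsum_S, <- IHn, <- word_sum_plus. apply word_sum_ext; auto. intros; apply rsum_S.
Qed.

(** This is the multinomial theorem, in its form as a sum over words. *)
Lemma word_sum_one k M w : word_sum k M (fun _ => 1) w = rsum k w ^ M.
Proof.
  induction M; simpl; [reflexivity|]. rewrite IHM.
  rewrite (rsum_ext k _ (fun i => rsum k w ^ M * w i)) by (intros; ring).
  rewrite rsum_scal; ring.
Qed.

Lemma word_sum_zero k M phi : word_sum k (S M) phi (fun _ => 0) = 0.
Proof.
  simpl. rewrite (rsum_ext k _ (fun _ => 0)) by (intros; ring).
  rewrite rsum_const; ring.
Qed.

Lemma dec_inc_same i nu : dec i (inc i nu) = nu.
Proof.
  apply functional_extensionality; intros j; unfold dec, inc.
  destruct (Nat.eqb_spec j i); auto.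
Qed.

Lemma inc_dec_same i nu : nu i <> O -> inc i (dec i nu) = nu.
Proof.
  intros H; apply functional_extensionality; intros j; unfold dec, inc.
  destruct (Nat.eqb_spec j i); subst; lia.
Qed.

Lemma inc_dec_comm i j nu : j <> i -> dec i (inc j nu) = inc j (dec i nu).
Proof.
  intros H; apply functional_extensionality; intros l; unfold dec, inc.
  destruct (Nat.eqb_spec l i), (Nat.eqb_spec l j); subst; congruence.
Qed.

(** The reason is the multinomial identity [nu_i * (M+1)!/nu! = (M+1) * M!/(nu - e_i)!], proved here
    on words by splitting off the first letter. *)
Lemma word_sum_shift k M i phi w : (i < k)%nat ->
  word_sum k (S M) (fun nu => INR (nu i) * phi (dec i nu)) w = INR (S M) * w i * word_sum k M phi w.
Proof.
  intros Hi.
  (* If the first letter is [i], it adds one to the count of [i]; this surplus gives the last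
     summand. *)
  assert (Step : forall M phi,
    word_sum k (S M) (fun nu => INR (nu i) * phi (dec i nu)) w =
    rsum k (fun j => w j * word_sum k M (fun nu => INR (nu i) * phi (inc j (dec i nu))) w)
    + w i * word_sum k M phi w).
  { clear M phi; intros M phi. cbn [word_sum].
    rewrite <- (rsum_single k i (fun j => w j * word_sum k M phi w) Hi), <- rsum_plus.
    apply rsum_ext; intros j Hj.
    destruct (Nat.eqb_spec j i) as [->|Hne].
    - rewrite <- Rmult_plus_distr_l, <- word_sum_plus. f_equal. apply word_sum_ext; auto. intros nu.
      rewrite dec_inc_same. replace (inc i nu i) with (S (nu i)).
      2:{ unfold inc. now rewrite Nat.eqb_refl. }
      (* [inc i (dec i nu)] differs from [nu] when [nu i] is 0, but then its factor vanishes. *)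
      rewrite S_INR. destruct (Nat.eq_dec (nu i) 0) as [H0|H0].
      + rewrite H0; simpl; ring.
      + rewrite inc_dec_same by auto; ring.
    - rewrite Rplus_0_r. f_equal. apply word_sum_ext; auto. intros nu.
      rewrite inc_dec_comm by auto. unfold inc at 1.
      destruct (Nat.eqb_spec i j); [congruence|reflexivity]. }
  revert phi; induction M as [|M IH]; intros phi; rewrite Step.
  - simpl word_sum. rewrite (rsum_ext k _ (fun _ => 0)) by (intros; simpl; ring).
    rewrite rsum_const; simpl; ring.
  - rewrite (rsum_ext k _ (fun j => INR (S M) * w i * (w j * word_sum k M (fun nu => phi (inc j nu)) w))).
    + rewrite rsum_scal. change (rsum k _) with (word_sum k (S M) phi w).
      rewrite (S_INR (S M)); ring.
    + intros j Hj. rewrite (IH (fun nu => phi (inc j nu))). ring.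
Qed.

Lemma weight_dec k i nu M : (i < k)%nat -> nu i <> O ->
  weight k nu (S M) -> weight k (dec i nu) M.
Proof.
  unfold weight; intros Hi Hn H.
  rewrite (rsum_ext k _ (fun j => INR (nu j) - (if Nat.eqb j i then 1 else 0))).
  - rewrite rsum_minus, (rsum_single k i (fun _ => 1)), H, S_INR by auto; ring.
  - intros j Hj; unfold dec. destruct (Nat.eqb_spec j i) as [->|]; [|ring].
    destruct (nu i); [congruence|]. rewrite S_INR; simpl; ring.
Qed.

Lemma weight_inc k i nu M : (i < k)%nat ->
  weight k nu M -> weight k (inc i nu) (S M).
Proof.
  unfold weight; intros Hi H.
  rewrite (rsum_ext k _ (fun j => INR (nu j) + (if Nat.eqb j i then 1 else 0))).
  - rewrite rsum_plus, (rsum_single k i (fun _ => 1)), H, S_INR by auto; ring.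
  - intros j Hj; unfold inc. destruct (Nat.eqb_spec j i) as [->|]; [|ring].
    rewrite S_INR; ring.
Qed.

Lemma weight_le k i nu M : (i < k)%nat -> weight k nu M -> INR (nu i) <= INR M.
Proof.
  unfold weight; intros Hi <-. apply (rsum_term_le k (fun i => INR (nu i))); auto.
  intros; apply pos_INR.
Qed.

(* Sampling a polynomial without replacement: multiplication by the variable
   [w_i] acts on the coefficients of the expansion [word_sum k M] by [word_sum_shift]. *)
Fixpoint sample (p : mpoly) (Phi : nat -> (nat -> nat) -> R) (M : nat)
    (nu : nat -> nat) : R :=
  match p with
  | PVar i => INR (nu i) / INR M * Phi (pred M) (dec i nu)
  | PConst c => c * Phi M nu
  | PAdd p q => sample p Phi M nu + sample q Phi M nu
  | PMul p q => sample p (sample q Phi) M nu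
  end.

(** For large [M], [Phi M] holds the coefficients of [s^M q(w/s)] with [s = rsum k w], multinomial
    factors removed, and they approximate the values [q(nu/M)] with error [N/M]. One number [N]
    serves as threshold and as error constant. *)
Definition represents (k : nat) (Phi : nat -> (nat -> nat) -> R) (q : mpoly) (N : nat) :=
  forall M, (N <= M)%nat ->
    (forall w, rsum k w <> 0 ->
      word_sum k M (Phi M) w = rsum k w ^ M * peval (fun i => w i / rsum k w) q) /\
    (forall nu, weight k nu M ->
      INR M * Rabs (Phi M nu - peval (fun i => INR (nu i) / INR M) q) <= INR N).

Lemma represents_mono k Phi q N N' :
  (N <= N')%nat -> represents k Phi q N -> represents k Phi q N'.
Proof.
  intros HN H M HM. destruct (H M ltac:(lia)) as [H1 H2]. split; auto.
  intros nu Hnu. eapply Rle_trans; [now apply H2|]. now apply le_INR.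
Qed.

Lemma represents_ext k Phi q q' N :
  (forall x, peval x q = peval x q') -> represents k Phi q N -> represents k Phi q' N.
Proof.
  intros E0 H M HM. destruct (H M HM) as [H1 H2].
  split; intros; rewrite <- E0; auto.
Qed.

Lemma nat_upper (r : R) : exists N, r <= INR N.
Proof. destruct (INR_unbounded r) as [N HN]. exists N; lra. Qed.

(** Multiplying by [w_i/s] turns the coefficient at [nu] into [nu_i/M] times the previous one at
    [nu - e_i], by [word_sum_shift]. The nodes [(nu - e_i)/(M-1)] and [nu/M] are at distance
    [O(1/M)], so Lipschitz continuity of [q] keeps the error of order [1/M]. *)
Lemma represents_var k i q N Phi : (i < k)%nat -> vars_lt k q ->
  represents k Phi q N ->
  exists N', represents k (sample (PVar i) Phi) (PMul (PVar i) q) N'.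
Proof.
  intros Hi Hq H.
  destruct (peval_lipschitz k q Hq 1 ltac:(lra)) as [L [HL HLip]].
  (* [2 * INR N] comes from the old error, as [S M <= 2 * M], and [2 * L] from moving the node by at
     most [2 / INR (S M)]. *)
  destruct (nat_upper (2 * INR N + 2 * L)) as [N1 HN1].
  (* Two successors keep the predecessor of [M] positive after the case split. *)
  exists (S (S (N + N1))). intros M HM. destruct M as [|M]; [lia|].
  destruct (H M ltac:(lia)) as [H1 H2]. split.
  - intros w Hw. cbn [sample pred].
    rewrite (word_sum_ext k (S M) _ (fun nu => / INR (S M) * (INR (nu i) * Phi M (dec i nu))) w w);
      [|intros; unfold Rdiv; ring|auto].
    rewrite word_sum_scal, word_sum_shift, H1 by auto. cbn [peval pow].
    field. split; auto. apply not_0_INR; lia.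
  - intros nu Hnu. cbn [sample pred peval].
    assert (HMp : 0 < INR M) by (apply lt_0_INR; lia).
    assert (HM1 : 1 <= INR M) by (change 1 with (INR 1); apply le_INR; lia).
    assert (HSM : 0 < INR (S M)) by (apply lt_0_INR; lia).
    pose proof (weight_le k i nu (S M) Hi Hnu) as Hle. pose proof (pos_INR (nu i)).
    (* If [nu i] is 0, [dec i] truncates, but both terms carry the factor 0. *)
    destruct (Nat.eq_dec (nu i) 0) as [Hz|Hz].
    { rewrite Hz. simpl (INR 0). unfold Rdiv. rewrite !Rmult_0_l, Rminus_0_r, Rabs_R0, Rmult_0_r.
      apply pos_INR. }
    pose proof (weight_dec k i nu M Hi Hz Hnu) as Hd. specialize (H2 _ Hd).
    destruct (HLip (fun j => INR (dec i nu j) / INR M) (fun j => INR (nu j) / INR (S M))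
                (2 / INR (S M))) as [_ [_ HLd]].
    { apply Rlt_le, Rdiv_lt_0_compat; lra. }
    { intros j Hj. pose proof (weight_le k j _ _ Hj Hd). pose proof (pos_INR (dec i nu j)).
      rewrite Rabs_pos_eq.
      - apply Rmult_le_reg_r with (INR M); auto. unfold Rdiv.
        rewrite Rmult_assoc, Rinv_l; lra.
      - apply Rmult_le_pos; auto. apply Rlt_le, Rinv_0_lt_compat; auto. }
    { intros j Hj. pose proof (weight_le k j _ _ Hj Hnu). pose proof (pos_INR (nu j)).
      rewrite Rabs_pos_eq.
      - apply Rmult_le_reg_r with (INR (S M)); auto. unfold Rdiv.
        rewrite Rmult_assoc, Rinv_l; lra.
      - apply Rmult_le_pos; auto. apply Rlt_le, Rinv_0_lt_compat; auto. }
    { intros j Hj.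
      pose proof (weight_le k j _ _ Hj Hd). pose proof (pos_INR (dec i nu j)).
      (* [e] is 1 at the coordinate [i] and 0 elsewhere; the nodes then differ by
         [(a / INR M - e) / INR (S M)], with [a / INR M] and [e] in [[0, 1]]. *)
      assert (D : exists e, 0 <= e <= 1 /\ INR (nu j) = INR (dec i nu j) + e).
      { unfold dec. destruct (Nat.eqb_spec j i) as [->|].
        - exists 1. split; [lra|]. destruct (nu i); [congruence|]. now rewrite S_INR.
        - exists 0. split; [lra|ring]. }
      destruct D as [e [He ->]]. set (a := INR (dec i nu j)) in *.
      replace (a / INR M - (a + e) / INR (S M))
        with ((a / INR M - e) / INR (S M)) by (rewrite S_INR; field; split; rewrite <- ?S_INR; lra).
      assert (0 <= a / INR M <= 1).
      { split.
        - apply Rmult_le_pos; auto. apply Rlt_le, Rinv_0_lt_compat; auto.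
        - apply Rmult_le_reg_r with (INR M); auto. unfold Rdiv.
          rewrite Rmult_assoc, Rinv_l; lra. }
      unfold Rdiv at 1. rewrite Rabs_mult, (Rabs_pos_eq (/ _)).
      2:{ apply Rlt_le, Rinv_0_lt_compat; auto. }
      unfold Rdiv at 2. apply Rmult_le_compat_r.
      - apply Rlt_le, Rinv_0_lt_compat; auto.
      - apply Rabs_le; lra. }
    set (A := Phi M (dec i nu)) in *.
    set (B := peval (fun j => INR (dec i nu j) / INR M) q) in *.
    set (C := peval (fun j => INR (nu j) / INR (S M)) q) in *.
    replace (INR (nu i) / INR (S M) * A - INR (nu i) / INR (S M) * C)
      with (INR (nu i) / INR (S M) * (A - C)) by ring.
    rewrite Rabs_mult, (Rabs_pos_eq (INR (nu i) / INR (S M))).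
    2:{ apply Rmult_le_pos; auto. apply Rlt_le, Rinv_0_lt_compat; auto. }
    replace (INR (S M) * (INR (nu i) / INR (S M) * Rabs (A - C)))
      with (INR (nu i) * Rabs (A - C)) by (field; lra).
    assert (HAC : INR (S M) * Rabs (A - C) <= 2 * INR N + 2 * L).
    { assert (T : Rabs (A - C) <= Rabs (A - B) + Rabs (B - C)).
      { replace (A - C) with ((A - B) + (B - C)) by ring. apply Rabs_triang. }
      assert (INR (S M) * Rabs (A - B) <= 2 * INR N).
      { pose proof (Rabs_pos (A - B)). rewrite S_INR. nra. }
      assert (INR (S M) * Rabs (B - C) <= 2 * L).
      { apply Rle_trans with (INR (S M) * (L * (2 / INR (S M)))).
        - apply Rmult_le_compat_l; lra.
        - right; field; lra. }
      nra. }
    assert (INR N1 <= INR (S (S (N + N1)))) by (apply le_INR; lia).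
    apply Rle_trans with (INR (S M) * Rabs (A - C)); [|lra].
    apply Rmult_le_compat_r; [apply Rabs_pos|auto].
Qed.

(** Induction on [p] for all [q] at once: a product [p1 p2] acts on [q] first by [p2], then by [p1],
    so the main estimate is the one for a variable. *)
Lemma represents_mul k p : vars_lt k p -> forall q N Phi, vars_lt k q ->
  represents k Phi q N ->
  exists N', represents k (sample p Phi) (PMul p q) N'.
Proof.
  induction p as [i|c|p1 IH1 p2 IH2|p1 IH1 p2 IH2]; intros Hp q N Phi Hq H.
  - now apply represents_var with N.
  - destruct (nat_upper (Rabs c * INR N)) as [N1 HN1].
    exists (N + N1)%nat. intros M HM. destruct (H M ltac:(lia)) as [H1 H2]. split.
    + intros w Hw. cbn [sample peval]. rewrite (word_sum_scal k M c (Phi M)), H1 by auto. ring.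
    + intros nu Hnu. cbn [sample peval]. rewrite <- Rmult_minus_distr_l, Rabs_mult.
      specialize (H2 nu Hnu). pose proof (Rabs_pos c).
      assert (INR N1 <= INR (N + N1)) by (apply le_INR; lia). nra.
  - destruct Hp as [Hp1 Hp2].
    destruct (IH1 Hp1 q N Phi Hq H) as [N1 G1]. destruct (IH2 Hp2 q N Phi Hq H) as [N2 G2].
    exists (N1 + N2)%nat. intros M HM.
    destruct (G1 M ltac:(lia)) as [A1 B1]. destruct (G2 M ltac:(lia)) as [A2 B2]. split.
    + intros w Hw. cbn [sample]. rewrite (word_sum_plus k M (sample p1 Phi M) (sample p2 Phi M)).
      rewrite A1, A2 by auto. cbn [peval]. ring.
    + intros nu Hnu. cbn [sample]. specialize (B1 nu Hnu). specialize (B2 nu Hnu).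
      cbn [peval] in *. rewrite plus_INR.
      match goal with |- _ * Rabs (?a + ?b - (?c + ?d) * ?e) <= _ =>
        replace (a + b - (c + d) * e) with ((a - c * e) + (b - d * e)) by ring;
        pose proof (Rabs_triang (a - c * e) (b - d * e)) end.
      pose proof (pos_INR M). nra.
  - destruct Hp as [Hp1 Hp2].
    destruct (IH2 Hp2 q N Phi Hq H) as [N2 G2].
    destruct (IH1 Hp1 (PMul p2 q) N2 (sample p2 Phi) (conj Hp2 Hq) G2) as [N1 G1].
    exists N1. eapply represents_ext; [|exact G1]. intros; simpl; ring.
Qed.

(** The constant 1 gives the coefficients of [s^M], multinomial factors removed; sampling from it
    yields those of [s^M p(w/s)]. *)
Definition coef (p : mpoly) : nat -> (nat -> nat) -> R := sample p (fun _ _ => 1).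

Lemma represents_coef k p : vars_lt k p -> exists N, represents k (coef p) p N.
Proof.
  intros Hp. destruct (represents_mul k p Hp (PConst 1) 0 (fun _ _ => 1) I) as [N H].
  - intros M _. split.
    + intros w _. rewrite word_sum_one. simpl; ring.
    + intros nu _. simpl. rewrite Rminus_diag, Rabs_R0; lra.
  - exists N. eapply represents_ext; [|exact H]. intros; simpl; ring.
Qed.

(** * Sums of squares *)

Definition qform (n : nat) (a : nat -> nat -> R) (y : nat -> R) : R :=
  rsum n (fun i => rsum n (fun j => y i * y j * a i j)).

Lemma qform_ext n a a' y y' :
  (forall i j, (i < n)%nat -> (j < n)%nat -> a i j = a' i j) ->
  (forall i, (i < n)%nat -> y i = y' i) -> qform n a y = qform n a' y'.
Proof.
  intros H Hy. apply rsum_ext; intros i Hi. apply rsum_ext; intros j Hj.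
  now rewrite H, !Hy.
Qed.

Lemma qform_plus n a b y :
  qform n (fun i j => a i j + b i j) y = qform n a y + qform n b y.
Proof.
  unfold qform. rewrite <- rsum_plus. apply rsum_ext; intros i Hi.
  rewrite <- rsum_plus. apply rsum_ext; intros j Hj. ring.
Qed.

Lemma qform_scal n c a y : qform n (fun i j => c * a i j) y = c * qform n a y.
Proof.
  unfold qform. rewrite <- rsum_scal. apply rsum_ext; intros i Hi.
  rewrite <- rsum_scal. apply rsum_ext; intros j Hj. ring.
Qed.

Lemma qform_rank_one n b y :
  qform n (fun i j => b i * b j) y = rsum n (fun i => b i * y i) ^ 2.
Proof.
  unfold qform. set (T := rsum n (fun i => b i * y i)).
  rewrite (rsum_ext n _ (fun i => T * (b i * y i))).
  - rewrite rsum_scal. fold T. ring.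
  - intros i Hi. unfold T. rewrite Rmult_comm, <- rsum_scal.
    apply rsum_ext; intros; ring.
Qed.

Lemma qform_diag n c y :
  qform n (fun i j => if Nat.eqb j i then c else 0) y = c * nrm2 n y.
Proof.
  unfold qform, nrm2. rewrite <- rsum_scal. apply rsum_ext; intros i Hi.
  rewrite (rsum_ext n _ (fun j => if Nat.eqb j i then y i * y j * c else 0)).
  - rewrite (rsum_single n i (fun j => y i * y j * c)) by auto. ring.
  - intros j Hj. destruct (Nat.eqb j i); ring.
Qed.

Lemma qform_S n a y :
  qform (S n) a y =
  qform n a y + y n * rsum n (fun i => (a i n + a n i) * y i) + y n * y n * a n n.
Proof.
  unfold qform. rewrite rsum_S.
  rewrite (rsum_ext n (fun i => rsum (S n) _)
    (fun i => rsum n (fun j => y i * y j * a i j) + y n * (a i n * y i))).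
  2:{ intros; rewrite rsum_S; ring. }
  rewrite rsum_plus, rsum_S, rsum_scal.
  rewrite (rsum_ext n (fun i => (a i n + a n i) * y i) (fun i => a i n * y i + a n i * y i))
    by (intros; ring).
  rewrite rsum_plus.
  rewrite (rsum_ext n (fun j => y n * y j * a n j) (fun j => y n * (a n j * y j)))
    by (intros; ring).
  rewrite rsum_scal. ring.
Qed.

(** Completing the square in the last variable leaves the Schur complement, again positive definite,
    and induction applies. As [a] is an arbitrary matrix, [b] averages its last row and column. *)
Lemma qform_pd_squares n : forall a,
  (forall y, nonzero_vec n y -> 0 < qform n a y) ->
  exists ls : list (nat -> R), forall y,
    qform n a y = lsum (map (fun l => rsum n (fun i => l i * y i) ^ 2) ls).
Proof.
  induction n as [|n IH]; intros a Ha.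
  - exists []. reflexivity.
  - set (p := a n n). set (b := fun i => (a i n + a n i) / 2).
    assert (Hp : 0 < p).
    { set (e := fun i => if Nat.eqb i n then 1 else 0).
      assert (He : forall i, (i < n)%nat -> e i = 0).
      { intros i Hi; unfold e. destruct (Nat.eqb_spec i n); [lia|auto]. }
      assert (Hen : e n = 1) by (unfold e; now rewrite Nat.eqb_refl).
      replace p with (qform (S n) a e).
      - apply Ha. exists n. split; [lia|]. lra.
      - rewrite qform_S, Hen.
        rewrite (qform_ext n a a e (fun i => 0)).
        + rewrite (rsum_ext n _ (fun i => 0)) by (intros; rewrite He by auto; ring).
          rewrite rsum_const. unfold qform, p.
          rewrite (rsum_ext n _ (fun i => 0)), rsum_const; [ring|].
          intros; rewrite (rsum_ext n _ (fun i => 0)), rsum_const; intros; ring.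
        + auto.
        + auto. }
    assert (Square : forall y, qform (S n) a y =
      qform n (fun i j => a i j + - / p * (b i * b j)) y
      + p * (y n + / p * rsum n (fun i => b i * y i)) ^ 2).
    { intros y. rewrite qform_S, qform_plus, qform_scal, qform_rank_one. fold p.
      rewrite (rsum_ext n (fun i => (a i n + a n i) * y i) (fun i => 2 * (b i * y i)))
        by (intros; unfold b; field).
      rewrite rsum_scal. field. lra. }
    destruct (IH (fun i j => a i j + - / p * (b i * b j))) as [ls Hls].
    { intros y Hy. set (T := rsum n (fun i => b i * y i)).
      (* The last coordinate of [y'] makes the completed square vanish, so the Schur complement at
         [y] equals the full form at [y']. *)
      set (y' := fun i => if Nat.eqb i n then - / p * T else y i).
      assert (Hlt : forall i, (i < n)%nat -> y' i = y i).
      { intros i Hi; unfold y'. destruct (Nat.eqb_spec i n); [lia|auto]. }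
      assert (Hyn : y' n = - / p * T) by (unfold y'; now rewrite Nat.eqb_refl).
      replace (qform n _ y) with (qform (S n) a y').
      - apply Ha. destruct Hy as [i [Hi Hy]]. exists i. split; [lia|].
        now rewrite Hlt.
      - rewrite Square, Hyn.
        rewrite (rsum_ext n (fun i => b i * y' i) (fun i => b i * y i)).
        2:{ intros i Hi; now rewrite Hlt. }
        fold T. replace (- / p * T + / p * T) with 0 by ring.
        rewrite pow_i, Rmult_0_r, Rplus_0_r by lia. now apply qform_ext. }
    exists ((fun i => if Nat.eqb i n then sqrt p else sqrt p * / p * b i) ::
            map (fun l i => if Nat.eqb i n then 0 else l i) ls).
    intros y. rewrite Square, Hls. cbn [map]. rewrite map_map. cbn [lsum fold_right].
    rewrite Rplus_comm. f_equal.
    + rewrite rsum_S, Nat.eqb_refl. symmetry.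
      rewrite (rsum_ext n _ (fun i => sqrt p * / p * (b i * y i))).
      2:{ intros i Hi. destruct (Nat.eqb_spec i n); [lia|ring]. }
      rewrite rsum_scal.
      replace (sqrt p * / p * rsum n (fun i => b i * y i) + sqrt p * y n)
        with (sqrt p * (y n + / p * rsum n (fun i => b i * y i))) by ring.
      rewrite Rpow_mult_distr, pow2_sqrt; lra.
    + apply lsum_map_ext. intros l _. rewrite rsum_S, Nat.eqb_refl. f_equal.
      rewrite Rmult_0_l, Rplus_0_r. apply rsum_ext. intros i Hi.
      destruct (Nat.eqb_spec i n); [lia|ring].
Qed.

(* Functions that are sums of squares of polynomials in [z_0, ..., z_k] modulo
   [z_k ^ 2 = z_0 ^ 2 + ... + z_(n-1) ^ 2]: the variable [z_k] plays the norm of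
   [x], with either sign. *)
Definition cone (n k : nat) (F : (nat -> R) -> R) : Prop :=
  exists qs : list mpoly, Forall (vars_lt (S k)) qs /\
    forall z, z k * z k = nrm2 n z -> F z = lsum (map (fun q => peval z q ^ 2) qs).

Lemma cone_ext n k F G :
  (forall z, z k * z k = nrm2 n z -> F z = G z) -> cone n k F -> cone n k G.
Proof. intros H [qs [H1 H2]]. exists qs. split; auto. intros. rewrite <- H; auto. Qed.

Lemma cone_0 n k : cone n k (fun _ => 0).
Proof. exists []. split; auto. Qed.

Lemma cone_plus n k F G : cone n k F -> cone n k G -> cone n k (fun z => F z + G z).
Proof.
  intros [qs [H1 H2]] [qs' [H1' H2']]. exists (qs ++ qs'). split.
  - now apply Forall_app.
  - intros z Hz. now rewrite map_app, lsum_app, H2, H2'.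
Qed.

Lemma cone_sqr_mul n k q F : vars_lt (S k) q -> cone n k F ->
  cone n k (fun z => peval z q ^ 2 * F z).
Proof.
  intros Hq [qs [H1 H2]]. exists (map (PMul q) qs). split.
  - apply Forall_map. eapply Forall_impl; [|exact H1]. intros; simpl; auto.
  - intros z Hz. rewrite H2, map_map, <- lsum_scal by auto.
    apply lsum_map_ext. intros; simpl; ring.
Qed.

Lemma cone_mul n k F G : cone n k F -> cone n k G -> cone n k (fun z => F z * G z).
Proof.
  intros [qs [H1 H2]] HG.
  apply (cone_ext n k (fun z => lsum (map (fun q => peval z q ^ 2) qs) * G z)).
  { intros z Hz; now rewrite H2. }
  clear H2. induction H1 as [|q qs Hq Hqs IH].
  - apply (cone_ext n k (fun _ => 0)); [intros; simpl; ring|apply cone_0].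
  - apply (cone_ext n k (fun z => peval z q ^ 2 * G z +
             lsum (map (fun q => peval z q ^ 2) qs) * G z)).
    + intros; unfold lsum; simpl; ring.
    + apply cone_plus; auto using cone_sqr_mul.
Qed.

Lemma cone_scal n k c F : 0 <= c -> cone n k F -> cone n k (fun z => c * F z).
Proof.
  intros Hc HF. apply (cone_ext n k (fun z => peval z (PConst (sqrt c)) ^ 2 * F z)).
  - intros; cbn [peval]. rewrite pow2_sqrt; auto.
  - apply cone_sqr_mul; simpl; auto.
Qed.

Lemma cone_rsum n k m F : (forall i, (i < m)%nat -> cone n k (F i)) ->
  cone n k (fun z => rsum m (fun i => F i z)).
Proof.
  induction m; intros H.
  - apply cone_0.
  - apply (cone_ext n k (fun z => rsum m (fun i => F i z) + F m z)).
    + intros; now rewrite rsum_S.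
    + apply cone_plus; auto.
Qed.

(** The coefficients may depend on [z], since they will be sums of squares of linear forms in
    [y]. *)
Lemma cone_word_sum n k m W : (forall i, (i < m)%nat -> cone n k (fun z => W z i)) ->
  forall M phi, (forall nu, weight m nu M -> cone n k (fun z => phi z nu)) ->
  cone n k (fun z => word_sum m M (phi z) (W z)).
Proof.
  intros HW M; induction M; intros phi H; cbn [word_sum].
  - apply (H (fun _ => O)). unfold weight. rewrite rsum_const; simpl; ring.
  - apply cone_rsum. intros i Hi. apply cone_mul; auto.
    apply (IHM (fun z nu => phi z (inc i nu))). intros nu Hnu. apply H.
    now apply weight_inc.
Qed.

(* [2 (|x|^2 +- t x_i) = (x_i +- t)^2 + sum over j <> i of x_j^2] when [t^2 = |x|^2]. *)
Lemma cone_weight n k i c : (n <= k)%nat -> (i < n)%nat -> c * c = 1 ->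
  cone n k (fun z => 2 * nrm2 n z + 2 * (c * z k * z i)).
Proof.
  intros Hk Hi Hc.
  exists (map (fun j => PAdd (PVar j)
            (if Nat.eqb j i then PMul (PConst c) (PVar k) else PConst 0)) (seq 0 n)).
  split.
  - apply Forall_map, Forall_forall. intros j Hj. apply in_seq in Hj.
    destruct (Nat.eqb j i); simpl; repeat split; lia.
  - intros z Hz. rewrite map_map, <- rsum_seq.
    rewrite (rsum_ext n _ (fun j => z j * z j +
      (if Nat.eqb j i then 2 * (c * z k * z j) + z k * z k else 0))).
    + rewrite rsum_plus, (rsum_single n i (fun j => 2 * (c * z k * z j) + z k * z k)) by auto.
      rewrite Hz. fold (nrm2 n z). ring.
    + intros j Hj. destruct (Nat.eqb j i); cbn [peval]; [|ring].
      replace (z k * z k) with ((c * c) * (z k * z k)) by (rewrite Hc; ring). ring.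
Qed.

(** Reduction modulo [z_k^2 = |x|^2] leaves degree at most 1 in [z_k]; [n <= k] ensures that [|x|^2]
    is free of [z_k]. *)
Lemma split_last n k q : (n <= k)%nat -> vars_lt (S k) q ->
  exists a b, vars_lt k a /\ vars_lt k b /\
    forall z, z k * z k = nrm2 n z -> peval z q = peval z a + z k * peval z b.
Proof.
  intros Hk; induction q as [i|c|p IHp q IHq|p IHp q IHq]; intros Hq.
  - destruct (Nat.eq_dec i k) as [->|Hne].
    + exists (PConst 0), (PConst 1). simpl. repeat split; auto. intros; ring.
    + exists (PVar i), (PConst 0). simpl in *. repeat split; auto; [lia|]. intros; ring.
  - exists (PConst c), (PConst 0). simpl. repeat split; auto. intros; ring.
  - destruct Hq as [H1 H2].
    destruct (IHp H1) as [a [b [Ha [Hb G]]]]. destruct (IHq H2) as [a' [b' [Ha' [Hb' G']]]].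
    exists (PAdd a a'), (PAdd b b'). simpl. repeat split; auto.
    intros z Hz. rewrite G, G' by auto. ring.
  - destruct Hq as [H1 H2].
    destruct (IHp H1) as [a [b [Ha [Hb G]]]]. destruct (IHq H2) as [a' [b' [Ha' [Hb' G']]]].
    exists (PAdd (PMul a a') (PMul (sumsq n) (PMul b b'))), (PAdd (PMul a b') (PMul b a')).
    pose proof (vars_lt_mono n k (sumsq n) Hk (vars_lt_sumsq n)).
    cbn [vars_lt]. repeat split; auto.
    intros z Hz. cbn [peval]. rewrite G, G', peval_sumsq, <- Hz by auto. ring.
Qed.

(* The sign change [t |-> - t] averages the cross terms [2 t a b] out. *)
Lemma cone_is_sos n k p : (n <= k)%nat -> vars_lt k p ->
  cone n k (fun z => peval z p) -> is_sos k p.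
Proof.
  intros Hk Hp [qs [Hqs H]].
  assert (Avg : exists qs', Forall (vars_lt k) qs' /\ forall z t, t * t = nrm2 n z ->
    / 2 * lsum (map (fun q => peval (fun i => if Nat.eqb i k then t else z i) q ^ 2) qs) +
    / 2 * lsum (map (fun q => peval (fun i => if Nat.eqb i k then - t else z i) q ^ 2) qs) =
    lsum (map (fun q => peval z q ^ 2) qs')).
  { clear H. induction Hqs as [|q qs Hq Hqs IH].
    - exists []. split; auto. intros; unfold lsum; simpl; ring.
    - destruct IH as [qs' [H1 H2]].
      destruct (split_last n k q Hk Hq) as [a [b [Ha [Hb G]]]].
      (* [(a + t b)^2] and [(a - t b)^2] average to [a^2 + t^2 b^2], and [t^2 b^2] is the sum of the
         [(x_i b)^2]. *)
      exists (a :: map (fun i => PMul (PVar i) b) (seq 0 n) ++ qs'). split.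
      + constructor; auto. apply Forall_app; split; auto.
        apply Forall_map, Forall_forall. intros i Hi. apply in_seq in Hi.
        simpl; split; auto; lia.
      + intros z t Ht.
        assert (Ev : forall t, t * t = nrm2 n z ->
          peval (fun i => if Nat.eqb i k then t else z i) q = peval z a + t * peval z b).
        { intros u Hu. rewrite G.
          - rewrite Nat.eqb_refl.
            rewrite (peval_ext k a _ z), (peval_ext k b _ z); auto;
              intros i Hi; destruct (Nat.eqb_spec i k); auto; lia.
          - rewrite Nat.eqb_refl, Hu. apply rsum_ext. intros i Hi.
            destruct (Nat.eqb_spec i k); auto; lia. }
        cbn [map]. rewrite map_app, map_map.
        change (lsum (?x :: ?l)) with (x + lsum l).
        rewrite lsum_app, <- H2 with (t := t), <- rsum_seq, !Ev by (auto; rewrite <- Ht; ring).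
        rewrite (rsum_ext n _ (fun i => peval z b ^ 2 * (z i * z i)))
          by (intros; cbn [peval]; ring).
        rewrite rsum_scal. fold (nrm2 n z). rewrite <- Ht. field. }
  destruct Avg as [qs' [H1 H2]]. exists qs'. split; auto. intros z.
  change (fold_right Rplus 0 ?l) with (lsum l).
  pose proof (sqrt_sqrt _ (nrm2_ge0 n z)) as Ht. set (t := sqrt (nrm2 n z)) in *.
  rewrite <- (H2 z t Ht).
  (* [p] is free of [z_k], so its value does not see whether [t] or [- t] is put there. *)
  assert (Ev : forall t, t * t = nrm2 n z -> peval z p =
    lsum (map (fun q => peval (fun i => if Nat.eqb i k then t else z i) q ^ 2) qs)).
  { intros u Hu. rewrite <- H.
    - apply (peval_ext k); auto. intros i Hi. destruct (Nat.eqb_spec i k); auto; lia.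
    - rewrite Nat.eqb_refl, Hu. apply rsum_ext. intros i Hi.
      destruct (Nat.eqb_spec i k); auto; lia. }
  rewrite <- (Ev t Ht), <- (Ev (- t)) by (rewrite <- Ht; ring). field.
Qed.

Lemma cone_qform_pd n k a : k = (n + n)%nat ->
  (forall y, nonzero_vec n y -> 0 < qform n a y) ->
  cone n k (fun z => qform n a (fun i => z (n + i)%nat)).
Proof.
  intros -> Ha. destruct (qform_pd_squares n a Ha) as [ls Hls].
  exists (map (fun l => psum n (fun i => PMul (PConst (l i)) (PVar (n + i)))) ls). split.
  - apply Forall_map, Forall_forall. intros l _. apply vars_lt_psum.
    intros i Hi; simpl; split; auto; lia.
  - intros z _. rewrite Hls, map_map. apply lsum_map_ext. intros l _.
    now rewrite peval_psum.
Qed.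

(** * Positive biforms *)

Lemma finite_threshold (A : nat -> nat -> Prop) n :
  (forall i N N', (N <= N')%nat -> A i N -> A i N') ->
  (forall i, (i < n)%nat -> exists N, A i N) ->
  exists N, forall i, (i < n)%nat -> A i N.
Proof.
  intros Hm; induction n as [|n IH]; intros H.
  - exists O. intros; lia.
  - destruct IH as [N1 H1]; [intros; apply H; lia|].
    destruct (H n ltac:(lia)) as [N2 H2]. exists (N1 + N2)%nat. intros i Hi.
    destruct (Nat.eq_dec i n) as [->|].
    + apply Hm with N2; auto; lia.
    + apply Hm with N1; [lia|apply H1; lia].
Qed.

Lemma qform_bound n a y e : 0 <= e ->
  (forall i j, (i < n)%nat -> (j < n)%nat -> Rabs (a i j) <= e) ->
  Rabs (qform n a y) <= INR n * INR n * e * nrm2 n y.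
Proof.
  intros He H. eapply Rle_trans; [apply rsum_abs|].
  replace (INR n * INR n * e * nrm2 n y)
    with (rsum n (fun _ => rsum n (fun _ => e * nrm2 n y))) by (rewrite !rsum_const; ring).
  apply rsum_le; intros i Hi. eapply Rle_trans; [apply rsum_abs|].
  apply rsum_le; intros j Hj. specialize (H i j Hi Hj).
  pose proof (nrm2_coord n y i Hi). pose proof (nrm2_coord n y j Hj).
  assert (Rabs (y i * y j) <= nrm2 n y).
  { apply Rabs_le. pose proof (pow2_ge_0 (y i - y j)). pose proof (pow2_ge_0 (y i + y j)).
    split; nra. }
  rewrite Rabs_mult, (Rmult_comm e). apply Rmult_le_compat; auto using Rabs_pos.
Qed.

Lemma word_sum_qform n k M (phi : nat -> nat -> (nat -> nat) -> R) y w :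
  word_sum k M (fun nu => qform n (fun i j => phi i j nu) y) w =
  qform n (fun i j => word_sum k M (phi i j) w) y.
Proof.
  unfold qform. rewrite word_sum_rsum. apply rsum_ext; intros i Hi.
  rewrite word_sum_rsum. apply rsum_ext; intros j Hj. apply word_sum_scal.
Qed.

(** The layout of variables is that of [hess_form]; with second derivatives for [p i j] the two
    agree by conversion. *)
Definition biform (n : nat) (p : nat -> nat -> mpoly) : mpoly :=
  psum n (fun i => psum n (fun j => PMul (PMul (PVar (n + i)) (PVar (n + j))) (p i j))).

Lemma peval_biform n p z :
  peval z (biform n p) = qform n (fun i j => peval z (p i j)) (fun i => z (n + i)%nat).
Proof.
  unfold biform, qform. rewrite peval_psum. apply rsum_ext; intros i Hi.
  rewrite peval_psum. apply rsum_ext; intros; reflexivity.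
Qed.

Lemma vars_lt_biform n p :
  (forall i j, (i < n)%nat -> (j < n)%nat -> vars_lt n (p i j)) ->
  vars_lt (n + n) (biform n p).
Proof.
  intros H. apply vars_lt_psum; intros i Hi. apply vars_lt_psum; intros j Hj.
  simpl. repeat split; try lia. apply vars_lt_mono with n; auto; lia.
Qed.

(** The difference [u_l - v_l], where [u] occupies the first [n] variables and [v] the next [n]. *)
Definition dvar (n l : nat) : mpoly := PAdd (PVar l) (PMul (PConst (-1)) (PVar (n + l))).

(* The penalty [C (1/n^2 - |u - v|^2)] keeps the form positive on the simplex near
   [u = v]; it vanishes at [u = (|x|^2 + t x)/(2 n |x|^2)], [v = (|x|^2 - t x)/(2 n |x|^2)]. *)
Definition lifted (n : nat) (p : nat -> nat -> mpoly) (C e : R) (i j : nat) : mpoly :=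
  PAdd (psubst (dvar n) (p i j))
    (if Nat.eqb j i
     then PMul (PConst C) (PAdd (PConst e) (PMul (PConst (-1))
            (psum n (fun l => PMul (dvar n l) (dvar n l)))))
     else PConst 0).

Lemma vars_lt_lifted n p C e i j : vars_lt n (p i j) -> vars_lt (n + n) (lifted n p C e i j).
Proof.
  intros Hp. split.
  - apply vars_lt_psubst with n; auto. intros; simpl; repeat split; lia.
  - destruct (Nat.eqb j i); simpl; repeat split.
    apply vars_lt_psum; intros; simpl; repeat split; lia.
Qed.

Lemma qform_lifted n p C e w y :
  qform n (fun i j => peval w (lifted n p C e i j)) y =
  qform n (fun i j => peval (fun l => w l - w (n + l)%nat) (p i j)) y
  + C * (e - nrm2 n (fun l => w l - w (n + l)%nat)) * nrm2 n y.
Proof.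
  rewrite <- qform_diag, <- qform_plus. apply qform_ext; auto. intros i j Hi Hj.
  assert (Ev : (fun l => peval w (dvar n l)) = (fun l => w l - w (n + l)%nat)).
  { apply functional_extensionality; intros l; simpl; ring. }
  unfold lifted. cbn [peval]. rewrite peval_psubst, Ev. f_equal.
  destruct (Nat.eqb j i); cbn [peval]; auto.
  rewrite peval_psum. unfold nrm2. cbn [peval].
  rewrite (rsum_ext n _ (fun l => (w l - w (n + l)%nat) * (w l - w (n + l)%nat)))
    by (intros; simpl; ring). ring.
Qed.

(** On the simplex [|u_i - v_i| <= u_i + v_i <= 1], so each square is at most [u_i + v_i], and these
    add up to 1. *)
Lemma nrm2_simplex n w : (forall i, (i < n + n)%nat -> 0 <= w i) -> rsum (n + n) w = 1 ->
  nrm2 n (fun l => w l - w (n + l)%nat) <= 1.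
Proof.
  intros Hw Hs. rewrite rsum_app, <- rsum_plus in Hs. rewrite <- Hs.
  apply rsum_le. intros i Hi.
  assert (H1 : w i + w (n + i)%nat <= 1).
  { rewrite <- Hs. apply (rsum_term_le n (fun i => w i + w (n + i)%nat)); auto.
    intros j Hj. pose proof (Hw j ltac:(lia)). pose proof (Hw (n + j)%nat ltac:(lia)). lra. }
  pose proof (Hw i ltac:(lia)). pose proof (Hw (n + i)%nat ltac:(lia)). nra.
Qed.

(** Compare [|u - v|^2] with [h = e/2]. Below [h] the penalty alone is at least [C h |y|^2]; above
    [h] the form is at least [2 C |y|^2], while the penalty is at least [- C |y|^2]. *)
Lemma lifted_pos n m p delta : (1 <= n)%nat -> 0 < delta ->
  (forall x y, 0 <= qform n (fun i j => peval x (p i j)) y) ->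
  (forall x y, nonzero_vec n x ->
     delta * nrm2 n x ^ m * nrm2 n y <= qform n (fun i j => peval x (p i j)) y) ->
  exists C eps, 0 < eps /\ forall w y,
    (forall i, (i < n + n)%nat -> 0 <= w i) -> rsum (n + n) w = 1 ->
    eps * nrm2 n y <= qform n (fun i j => peval w (lifted n p C (/ (INR n * INR n)) i j)) y.
Proof.
  intros Hn Hd Hnn Hpos.
  assert (HN : 1 <= INR n) by (change 1 with (INR 1); now apply le_INR).
  set (e := / (INR n * INR n)).
  assert (He : 0 < e <= 1).
  { assert (1 <= INR n * INR n) by nra. split.
    - apply Rinv_0_lt_compat; lra.
    - rewrite <- Rinv_1. apply Rinv_le_contravar; lra. }
  set (h := e / 2). assert (Hh : 0 < h <= 1/2) by (unfold h; lra).
  assert (Hhm : 0 < h ^ m) by (apply pow_lt; lra).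
  set (C := delta * h ^ m / 2). assert (HC : 0 < C) by (unfold C; nra).
  exists C, (C * h). split; [nra|]. intros w y Hw Hs.
  rewrite qform_lifted. set (x := fun l => w l - w (n + l)%nat).
  pose proof (nrm2_simplex n w Hw Hs) as Hx. fold x in Hx.
  pose proof (nrm2_ge0 n y) as Hy.
  destruct (Rle_dec (nrm2 n x) h) as [Hle|Hgt].
  - specialize (Hnn x y).
    assert (C * h * nrm2 n y <= C * (e - nrm2 n x) * nrm2 n y).
    { apply Rmult_le_compat_r; auto. apply Rmult_le_compat_l; unfold h in *; lra. }
    lra.
  - assert (Hnz : nonzero_vec n x) by (apply nrm2_pos_inv; lra).
    specialize (Hpos x y Hnz).
    assert (h ^ m <= nrm2 n x ^ m) by (apply pow_incr; lra).
    assert (2 * C * nrm2 n y <= delta * nrm2 n x ^ m * nrm2 n y).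
    { apply Rmult_le_compat_r; auto. unfold C. nra. }
    assert (- C * nrm2 n y <= C * (e - nrm2 n x) * nrm2 n y).
    { apply Rmult_le_compat_r; auto. nra. }
    assert (C * h * nrm2 n y <= C * nrm2 n y).
    { apply Rmult_le_compat_r; auto. nra. }
    lra.
Qed.

(** Each coefficient matrix differs entrywise by at most [N/M] from the matrix of the lifted form at
    the simplex point [nu/M], so the quadratic forms differ by at most [n^2 (N/M) |y|^2], less than
    the margin [eps |y|^2] for large [M]. *)
Lemma coef_pd n p eps : (forall i j, (i < n)%nat -> (j < n)%nat -> vars_lt n (p i j)) ->
  forall C e, 0 < eps ->
  (forall w y, (forall i, (i < n + n)%nat -> 0 <= w i) -> rsum (n + n) w = 1 ->
    eps * nrm2 n y <= qform n (fun i j => peval w (lifted n p C e i j)) y) ->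
  exists N, forall M, (N <= M)%nat ->
    (forall w i j, (i < n)%nat -> (j < n)%nat -> rsum (n + n) w <> 0 ->
      word_sum (n + n) M (coef (lifted n p C e i j) M) w =
      rsum (n + n) w ^ M * peval (fun l => w l / rsum (n + n) w) (lifted n p C e i j)) /\
    (forall nu, weight (n + n) nu M -> forall y, nonzero_vec n y ->
      0 < qform n (fun i j => coef (lifted n p C e i j) M nu) y).
Proof.
  intros Hp C e He H.
  assert (R : exists N, forall i, (i < n)%nat -> forall j, (j < n)%nat ->
            represents (n + n) (coef (lifted n p C e i j)) (lifted n p C e i j) N).
  { apply (finite_threshold (fun i N => forall j, (j < n)%nat ->
            represents (n + n) (coef (lifted n p C e i j)) (lifted n p C e i j) N)).
    - intros i N N' HN G j Hj. eapply represents_mono; eauto.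
    - intros i Hi.
      apply (finite_threshold (fun j N =>
            represents (n + n) (coef (lifted n p C e i j)) (lifted n p C e i j) N)).
      + intros; eapply represents_mono; eauto.
      + intros j Hj. apply represents_coef, vars_lt_lifted; auto. }
  destruct R as [N R].
  (* By this choice [n^2 N + 1 <= eps M] for [M >= N1]; the 1 makes the comparison strict. *)
  destruct (nat_upper ((INR n * INR n * INR N + 1) / eps)) as [N1 HN1].
  exists (S (N + N1)). intros M HM. split.
  - intros w i j Hi Hj Hw. destruct (R i Hi j Hj M ltac:(lia)) as [G _]. auto.
  - intros nu Hnu y Hy.
    assert (HMp : 0 < INR M) by (apply lt_0_INR; lia).
    set (w := fun i => INR (nu i) / INR M).
    assert (HL : eps * nrm2 n y <= qform n (fun i j => peval w (lifted n p C e i j)) y).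
    { apply H.
      - intros i _. unfold w. apply Rmult_le_pos; [apply pos_INR|].
        apply Rlt_le, Rinv_0_lt_compat; auto.
      - unfold w. rewrite (rsum_ext _ _ (fun i => / INR M * INR (nu i)))
          by (intros; unfold Rdiv; ring).
        rewrite rsum_scal. rewrite Hnu. field. lra. }
    set (a := fun i j => coef (lifted n p C e i j) M nu) in *.
    set (b := fun i j => peval w (lifted n p C e i j)) in *.
    assert (HB : Rabs (qform n (fun i j => a i j + - 1 * b i j) y)
                 <= INR n * INR n * (INR N / INR M) * nrm2 n y).
    { apply qform_bound.
      - apply Rmult_le_pos; [apply pos_INR|]. apply Rlt_le, Rinv_0_lt_compat; auto.
      - intros i j Hi Hj. destruct (R i Hi j Hj M ltac:(lia)) as [_ G].
        specialize (G nu Hnu). fold w in G. fold (b i j) in G. fold (a i j) in G.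
        replace (a i j + -1 * b i j) with (a i j - b i j) by ring.
        apply Rmult_le_reg_l with (INR M); auto.
        replace (INR M * (INR N / INR M)) with (INR N) by (field; lra). exact G. }
    rewrite qform_plus, qform_scal in HB.
    pose proof (Rle_abs (- (qform n a y + -1 * qform n b y))) as HA.
    rewrite Rabs_Ropp in HA.
    pose proof (nrm2_pos n y Hy) as Hyp.
    assert (HMN : INR n * INR n * (INR N / INR M) < eps).
    { apply Rmult_lt_reg_r with (INR M); auto.
      replace (INR n * INR n * (INR N / INR M) * INR M)
        with (INR n * INR n * INR N) by (field; lra).
      assert (INR N1 <= INR M) by (apply le_INR; lia).
      apply Rlt_le_trans with (INR n * INR n * INR N + 1); [lra|].
      apply Rle_trans with (eps * INR N1); [|nra].
      apply Rmult_le_reg_l with (/ eps); [now apply Rinv_0_lt_compat|].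
      replace (/ eps * (eps * INR N1)) with (INR N1) by (field; lra).
      unfold Rdiv in HN1. lra. }
    assert (INR n * INR n * (INR N / INR M) * nrm2 n y < eps * nrm2 n y)
      by (apply Rmult_lt_compat_r; auto).
    lra.
Qed.

(** Homogeneity is stated with [(t * t) ^ m], so that only [t^2 = e/|x|^2] enters the final identity
    and no square root survives. *)
Lemma positive_biform_sos n m p delta : (1 <= n)%nat -> 0 < delta ->
  (forall i j, (i < n)%nat -> (j < n)%nat -> vars_lt n (p i j)) ->
  (forall t x y, t <> 0 ->
     qform n (fun i j => peval (fun l => t * x l) (p i j)) y =
     (t * t) ^ m * qform n (fun i j => peval x (p i j)) y) ->
  (forall x y, 0 <= qform n (fun i j => peval x (p i j)) y) ->
  (forall x y, nonzero_vec n x ->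
     delta * nrm2 n x ^ m * nrm2 n y <= qform n (fun i j => peval x (p i j)) y) ->
  exists r, is_sos (n + n) (PMul (biform n p) (ppow (sumsq n) r)).
Proof.
  intros Hn Hd Hv Hhom Hnn Hpos.
  destruct (lifted_pos n m p delta Hn Hd Hnn Hpos) as [C [eps [Heps HL]]].
  set (e := / (INR n * INR n)) in *.
  destruct (coef_pd n p eps Hv C e Heps HL) as [N HN].
  (* The degree [S M'] exceeds both [N] and [m], which leaves the positive exponent [S M' - m]. *)
  set (M' := (N + m)%nat). destruct (HN (S M') ltac:(lia)) as [H1 H2]. clear HN.
  exists (S M' - m)%nat.
  assert (HNn : 0 < INR n) by (apply lt_0_INR; lia).
  set (k := (n + n)%nat) in *.
  (* The first [n] entries are the [u_i], the next [n] the [v_i], with [z k] as the norm of [x] up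
     to sign. *)
  set (W := fun (z : nat -> R) i => if Nat.ltb i n
     then 2 * nrm2 n z + 2 * (1 * z k * z i)
     else 2 * nrm2 n z + 2 * (-1 * z k * z (i - n)%nat)).
  assert (HWl : forall z l, (l < n)%nat -> W z l = 2 * nrm2 n z + 2 * (1 * z k * z l)).
  { intros z l Hl. unfold W. now rewrite (proj2 (Nat.ltb_lt l n) Hl). }
  assert (HWr : forall z l, W z (n + l)%nat = 2 * nrm2 n z + 2 * (-1 * z k * z l)).
  { intros z l. unfold W. rewrite (proj2 (Nat.ltb_ge _ _)) by lia.
    now replace (n + l - n)%nat with l by lia. }
  assert (HWs : forall z, rsum k (W z) = 4 * INR n * nrm2 n z).
  { intros z. unfold k. rewrite rsum_app, <- rsum_plus.
    rewrite (rsum_ext n _ (fun _ => 4 * nrm2 n z)).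
    - rewrite rsum_const; ring.
    - intros l Hl. rewrite HWl, HWr by auto. ring. }
  set (phi := fun (z : nat -> R) nu =>
    qform n (fun i j => coef (lifted n p C e i j) (S M') nu) (fun i => z (n + i)%nat)).
  assert (HC : cone n k (fun z => word_sum k (S M') (phi z) (W z))).
  { apply cone_word_sum.
    - intros i Hi. destruct (le_lt_dec n i) as [Hge|Hlt].
      + replace i with (n + (i - n))%nat by lia.
        apply (cone_ext n k (fun z => 2 * nrm2 n z + 2 * (-1 * z k * z (i - n)%nat))).
        * intros; now rewrite HWr.
        * apply cone_weight; unfold k in *; try lia. ring.
      + apply (cone_ext n k (fun z => 2 * nrm2 n z + 2 * (1 * z k * z i))).
        * intros; now rewrite HWl.
        * apply cone_weight; unfold k in *; try lia. ring.
    - intros nu Hnu. apply cone_qform_pd; auto. }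
  (* [c] is the constant in [(4 n s)^(S M') (e/s)^m = c s^(S M' - m)]. *)
  set (c := (4 * INR n) ^ S M' * e ^ m).
  assert (He : 0 < e) by (apply Rinv_0_lt_compat; nra).
  assert (Hc : 0 < c) by (apply Rmult_lt_0_compat; apply pow_lt; lra).
  apply (cone_is_sos n); [unfold k; lia| |].
  - split; [now apply vars_lt_biform|].
    apply vars_lt_ppow. apply vars_lt_mono with n; [unfold k; lia|apply vars_lt_sumsq].
  - apply (cone_ext n k (fun z => / c * word_sum k (S M') (phi z) (W z))).
    2:{ apply cone_scal; auto. apply Rlt_le, Rinv_0_lt_compat; auto. }
    intros z Hz. cbn [peval]. rewrite peval_biform, peval_ppow, peval_sumsq.
    pose proof (nrm2_ge0 n z). set (s := nrm2 n z) in *.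
    (* At [s = 0] division by the total weight is meaningless; there both sides vanish, since all
       weights are 0 and both exponents are positive. *)
    destruct (Req_dec s 0) as [Hs|Hs].
    + rewrite (word_sum_ext k (S M') (phi z) (phi z) (W z) (fun _ => 0)); auto.
      * rewrite word_sum_zero, Hs, pow_i; [ring|]. unfold M'; lia.
      * assert (z k = 0) by nra.
        intros i Hi. unfold W. destruct (Nat.ltb i n); fold s; rewrite Hs, H0; ring.
    + unfold phi. rewrite word_sum_qform.
      assert (Hsig : rsum k (W z) <> 0).
      { rewrite HWs. fold s. apply Rmult_integral_contrapositive; split; nra. }
      rewrite (qform_ext n _ (fun i j => rsum k (W z) ^ S M' *
         peval (fun l => W z l / rsum k (W z)) (lifted n p C e i j)) _ (fun i => z (n + i)%nat)); auto.
      rewrite qform_scal, qform_lifted.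
      (* The weights give [(u - v)/(4 n s) = t x] with [t^2 = e/s], hence [|t x|^2 = e] and the
         penalty vanishes. *)
      set (t := z k / (INR n * s)).
      assert (Ht : t * t = e * / s).
      { unfold t, e. replace (z k / (INR n * s) * (z k / (INR n * s)))
          with (z k * z k / (INR n * s * (INR n * s))) by (field; lra).
        rewrite Hz. field. lra. }
      rewrite (qform_ext n _ (fun i j => peval (fun l => t * z l) (p i j)) _ (fun i => z (n + i)%nat)); auto.
      2:{ intros i j Hi Hj. apply (peval_ext n); auto. intros l Hl.
          rewrite HWl, HWr, HWs by auto. fold s. unfold t. field. lra. }
      replace (nrm2 n _) with e.
      2:{ transitivity (nrm2 n (fun l => t * z l)).
          - rewrite nrm2_scal. fold s. rewrite Ht. field. auto.
          - apply rsum_ext. intros l Hl. rewrite HWl, HWr, HWs by auto. fold s.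
            unfold t. field. lra. }
      rewrite Hhom.
      2:{ intros H0. rewrite H0 in Ht. assert (0 < e * / s).
          { apply Rmult_lt_0_compat; auto. apply Rinv_0_lt_compat; lra. } lra. }
      rewrite HWs, Ht. fold s. rewrite !Rpow_mult_distr, pow_inv.
      replace (s ^ S M') with (s ^ (S M' - m) * s ^ m).
      2:{ rewrite <- pow_add. f_equal. unfold M'; lia. }
      unfold c. rewrite Rpow_mult_distr. field.
      repeat split; apply pow_nonzero; lra.
Qed.

(** * Derivatives *)

(** Ties the formal derivative to the analytic one, since homogeneity in [is_form] is a statement
    about functions. *)
Lemma pderiv_correct i p x :
  derivable_pt_lim (fun h => peval (fun j => x j + (if Nat.eqb i j then h else 0)) p) 0
    (peval x (pderiv i p)).
Proof.
  assert (H0 : forall q, peval (fun j => x j + (if Nat.eqb i j then 0 else 0)) q = peval x q).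
  { intros q. f_equal. apply functional_extensionality; intros j. destruct (Nat.eqb i j); ring. }
  induction p as [j|c|p IHp q IHq|p IHp q IHq]; cbn [peval pderiv].
  - destruct (Nat.eqb i j); cbn [peval].
    + replace 1 with (0 + 1) by ring.
      apply (derivable_pt_lim_plus (fun _ => x j) id).
      * apply derivable_pt_lim_const.
      * apply derivable_pt_lim_id.
    + apply (derivable_pt_lim_const (x j + 0)).
  - apply (derivable_pt_lim_const c).
  - apply (derivable_pt_lim_plus _ _ 0 _ _ IHp IHq).
  - pose proof (derivable_pt_lim_mult _ _ 0 _ _ IHp IHq) as H. cbv beta in H.
    rewrite !H0 in H. exact H.
Qed.

(** With [v] the [i]-th unit vector, differentiate [p(t (x + h v)) = t^(e+1) p(x + h v)] in [h] at 0
    by the chain rule, then cancel one factor [t]. *)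
Lemma pderiv_homogeneous e i p :
  (forall t x, t <> 0 -> peval (fun j => t * x j) p = t ^ S e * peval x p) ->
  forall t x, t <> 0 ->
    peval (fun j => t * x j) (pderiv i p) = t ^ e * peval x (pderiv i p).
Proof.
  intros H t x Ht.
  pose proof (derivable_pt_lim_scal _ (t ^ S e) 0 _ (pderiv_correct i p x)) as H1.
  pose proof (pderiv_correct i p (fun j => t * x j)) as H2.
  pose proof (derivable_pt_lim_scal _ t 0 _ (derivable_pt_lim_id 0)) as H3.
  (* The chain rule asks for the derivative at the inner value [t * 0]. *)
  replace 0 with (mult_real_fct t id 0) in H2 at 1 by (unfold mult_real_fct, id; ring).
  pose proof (derivable_pt_lim_comp _ _ 0 _ _ H3 H2) as H4.
  apply (Rmult_eq_reg_l t); auto.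
  replace (t * (t ^ e * peval x (pderiv i p)))
    with (t ^ S e * peval x (pderiv i p)) by (simpl; ring).
  rewrite Rmult_comm, <- (Rmult_1_r t) at 1.
  apply (uniqueness_limite _ 0 _ _ H4).
  eapply derivable_pt_lim_ext; [|exact H1]. intros h. unfold mult_real_fct, comp, id.
  rewrite <- H by auto. f_equal. apply functional_extensionality; intros j.
  destruct (Nat.eqb i j); ring.
Qed.

(** * Gradient and Hessian of products and of powers of [|x|^2] *)

Definition grad (n : nat) (p : mpoly) (x y : nat -> R) : R :=
  rsum n (fun i => y i * peval x (pderiv i p)).

Definition hess (n : nat) (p : mpoly) (x y : nat -> R) : R :=
  qform n (fun i j => peval x (pderiv j (pderiv i p))) y.

Lemma grad_mul n p q x y :
  grad n (PMul p q) x y = grad n p x y * peval x q + peval x p * grad n q x y.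
Proof.
  unfold grad. rewrite (Rmult_comm _ (peval x q)), <- !rsum_scal, <- rsum_plus.
  apply rsum_ext; intros; simpl; ring.
Qed.

Lemma hess_add n p q x y : hess n (PAdd p q) x y = hess n p x y + hess n q x y.
Proof. apply (qform_plus n). Qed.

Lemma qform_outer n a b y :
  qform n (fun i j => a i * b j) y = rsum n (fun i => y i * a i) * rsum n (fun i => y i * b i).
Proof.
  unfold qform. rewrite Rmult_comm, <- rsum_scal. apply rsum_ext; intros i Hi.
  rewrite Rmult_comm, <- rsum_scal. apply rsum_ext; intros; ring.
Qed.

Lemma hess_mul n p q x y :
  hess n (PMul p q) x y =
  peval x q * hess n p x y + peval x p * hess n q x y + 2 * (grad n p x y * grad n q x y).
Proof.
  unfold hess. rewrite <- !qform_scal.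
  replace (2 * (grad n p x y * grad n q x y))
    with (grad n p x y * grad n q x y + grad n q x y * grad n p x y) by ring.
  unfold grad. rewrite <- !qform_outer, <- !qform_plus. apply qform_ext; auto.
  intros; simpl; ring.
Qed.

Lemma hess_scal n c p x y : hess n (PMul (PConst c) p) x y = c * hess n p x y.
Proof.
  unfold hess. rewrite <- qform_scal. apply qform_ext; auto. intros; simpl; ring.
Qed.

Lemma pderiv_psum i n F : pderiv i (psum n F) = psum n (fun l => pderiv i (F l)).
Proof. unfold psum. induction (seq 0 n); simpl; congruence. Qed.

Lemma pderiv_sumsq n i x : (i < n)%nat -> peval x (pderiv i (sumsq n)) = 2 * x i.
Proof.
  intros Hi. unfold sumsq. rewrite pderiv_psum, peval_psum.
  rewrite <- (rsum_single n i (fun l => 2 * x l) Hi). apply rsum_ext; intros l _.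
  cbn [pderiv]. rewrite Nat.eqb_sym. destruct (Nat.eqb l i); simpl; ring.
Qed.

Lemma grad_sumsq n x y : grad n (sumsq n) x y = 2 * rsum n (fun i => x i * y i).
Proof.
  unfold grad. rewrite <- rsum_scal. apply rsum_ext; intros. rewrite pderiv_sumsq by auto. ring.
Qed.

Lemma hess_sumsq n x y : hess n (sumsq n) x y = 2 * nrm2 n y.
Proof.
  unfold hess. rewrite <- qform_diag. apply qform_ext; auto. intros i j Hi Hj.
  unfold sumsq. rewrite !pderiv_psum, peval_psum.
  rewrite <- (rsum_single n i (fun l => if Nat.eqb j l then 2 else 0) Hi).
  apply rsum_ext; intros l _.
  cbn [pderiv]. rewrite (Nat.eqb_sym i l).
  destruct (Nat.eqb l i), (Nat.eqb j l); simpl; ring.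
Qed.

Lemma grad_sumsq_pow n m x y :
  grad n (ppow (sumsq n) m) x y =
  2 * INR m * nrm2 n x ^ pred m * rsum n (fun i => x i * y i).
Proof.
  induction m as [|m IH].
  - unfold grad. simpl. rewrite (rsum_ext n _ (fun _ => 0)) by (intros; ring).
    rewrite rsum_const. ring.
  - cbn [ppow]. rewrite grad_mul, IH, grad_sumsq, peval_ppow, peval_sumsq, S_INR.
    destruct m; simpl; ring.
Qed.

(** Induction with the product rule. For [m] below 2 the terms in which [pred] truncates carry a
    factor 0. *)
Lemma hess_sumsq_pow n m x y :
  hess n (ppow (sumsq n) m) x y =
  2 * INR m * nrm2 n x ^ pred m * nrm2 n y +
  4 * INR m * INR (pred m) * nrm2 n x ^ pred (pred m) * rsum n (fun i => x i * y i) ^ 2.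
Proof.
  induction m as [|m IH].
  - unfold hess. rewrite (qform_ext n _ (fun _ _ => 0 * 0) y y) by (intros; simpl; ring).
    rewrite (qform_scal n 0 (fun _ _ => 0)). simpl; ring.
  - cbn [ppow]. rewrite hess_mul, IH, hess_sumsq, grad_sumsq, grad_sumsq_pow,
      peval_ppow, peval_sumsq, S_INR.
    destruct m as [|[|m]]; cbn [pred pow]; rewrite ?S_INR; simpl (INR 0); ring.
Qed.

(** With [b = x.y], the squared norm of [|y|^2 x - b y] is [|y|^2 (|x|^2 |y|^2 - b^2)]; the case
    [|y| = 0] is treated apart. *)
Lemma cauchy_schwarz n x y :
  rsum n (fun i => x i * y i) ^ 2 <= nrm2 n x * nrm2 n y.
Proof.
  set (b := rsum n (fun i => x i * y i)).
  assert (Exp : nrm2 n (fun i => nrm2 n y * x i - b * y i) =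
    nrm2 n y * (nrm2 n x * nrm2 n y - b ^ 2)).
  { set (Y := nrm2 n y).
    transitivity (rsum n (fun i => Y * Y * (x i * x i) - 2 * Y * b * (x i * y i)
                                  + b * b * (y i * y i))).
    - apply rsum_ext; intros; ring.
    - rewrite rsum_plus, rsum_minus, !rsum_scal.
      fold (nrm2 n x) (nrm2 n y) b Y. ring. }
  pose proof (nrm2_ge0 n (fun i => nrm2 n y * x i - b * y i)) as H. rewrite Exp in H.
  pose proof (nrm2_ge0 n x). pose proof (nrm2_ge0 n y).
  destruct (Req_dec (nrm2 n y) 0) as [Hy|Hy].
  - enough (b = 0) as -> by nra.
    unfold b. rewrite (rsum_ext n _ (fun _ => 0)); [rewrite rsum_const; ring|].
    intros i Hi. pose proof (nrm2_coord n y i Hi). assert (y i = 0) as -> by nra. ring.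
  - assert (0 < nrm2 n y) by lra.
    enough (0 <= nrm2 n x * nrm2 n y - b ^ 2) by lra.
    apply Rmult_le_reg_l with (nrm2 n y); lra.
Qed.

Lemma hess_sumsq_pow_pos n m x y : nonzero_vec n x -> nonzero_vec n y ->
  0 < hess n (ppow (sumsq n) (S m)) x y.
Proof.
  intros Hx%nrm2_pos Hy%nrm2_pos. rewrite hess_sumsq_pow. cbn [pred].
  pose proof (pos_INR m). pose proof (pow_lt _ m Hx). pose proof (pow_lt _ (pred m) Hx).
  pose proof (pow2_ge_0 (rsum n (fun i => x i * y i))).
  assert (0 < INR (S m)) by (apply lt_0_INR; lia).
  apply Rplus_lt_le_0_compat.
  - repeat apply Rmult_lt_0_compat; lra.
  - apply Rmult_le_pos; auto. apply Rmult_le_pos; [|lra]. apply Rmult_le_pos; lra.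
Qed.

(** Cauchy-Schwarz bounds the rank-one term by a multiple of [|x|^(2m) |y|^2]. *)
Lemma hess_sumsq_pow_le n m x y :
  hess n (ppow (sumsq n) (S m)) x y <=
  (2 * INR (S m) + 4 * INR (S m) * INR m) * nrm2 n x ^ m * nrm2 n y.
Proof.
  rewrite hess_sumsq_pow. cbn [pred].
  pose proof (cauchy_schwarz n x y) as CS. pose proof (pos_INR m). pose proof (pos_INR (S m)).
  destruct m as [|m].
  - simpl. lra.
  - cbn [pred]. pose proof (pow_le _ m (nrm2_ge0 n x)) as Hp.
    set (a := 4 * INR (S (S m)) * INR (S m)).
    assert (0 <= a) by (unfold a; apply Rmult_le_pos; lra).
    assert (a * nrm2 n x ^ m * rsum n (fun i => x i * y i) ^ 2
            <= a * nrm2 n x ^ m * (nrm2 n x * nrm2 n y)).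
    { apply Rmult_le_compat_l; auto. now apply Rmult_le_pos. }
    cbn [pow]. cbn [pow] in H2. lra.
Qed.

(** * Compactness *)

(** The compactness theorem of Coquelicot works on nested pairs, hence this passage between them and
    functions on [nat]. *)
Fixpoint to_Tn (k : nat) (z : nat -> R) : Compactness.Tn k R :=
  match k with
  | O => tt
  | S k => (z O, to_Tn k (fun i => z (S i)))
  end.

Fixpoint of_Tn (k : nat) : Compactness.Tn k R -> nat -> R :=
  match k with
  | O => fun _ _ => 0
  | S k => fun t i => match i with O => fst t | S i => of_Tn k (snd t) i end
  end.

Lemma of_to_Tn k z i : (i < k)%nat -> of_Tn k (to_Tn k z) i = z i.
Proof.
  revert z i; induction k; intros z i Hi; [lia|].
  destruct i; simpl; auto. apply (IHk (fun i => z (S i))). lia.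
Qed.

Lemma bounded_to_Tn k a b z : (forall i, (i < k)%nat -> a i <= z i <= b i) ->
  Compactness.bounded_n k (to_Tn k a) (to_Tn k b) (to_Tn k z).
Proof.
  revert a b z; induction k; intros a b z H; simpl; auto. split.
  - apply (H O); lia.
  - apply IHk. intros i Hi. apply (H (S i)); lia.
Qed.

Lemma bounded_of_Tn k a b t : Compactness.bounded_n k (to_Tn k a) (to_Tn k b) t ->
  forall i, (i < k)%nat -> a i <= of_Tn k t i <= b i.
Proof.
  revert a b t; induction k; intros a b t H i Hi; [lia|].
  destruct t as [t1 t2]. simpl in H. destruct H as [H1 H2].
  destruct i; simpl; auto. apply (IHk (fun i => a (S i)) (fun i => b (S i))); auto; lia.
Qed.

Lemma close_of_Tn k d s t : Compactness.close_n k d s t ->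
  forall i, (i < k)%nat -> Rabs (of_Tn k s i - of_Tn k t i) < d.
Proof.
  revert s t; induction k; intros s t H i Hi; [lia|].
  destruct s as [s1 s2], t as [t1 t2]. simpl in H. destruct H as [H1 H2].
  destruct i; simpl; auto. apply IHk; auto; lia.
Qed.

(** Every tag gets a radius that is also a lower bound of [F] on nearby points of [K = 1];
    compactness of the cube then yields one [d] below suitable radii for all points. *)
Lemma compact_lower_bound k F K : vars_lt k F -> vars_lt k K ->
  (forall z, (forall i, (i < k)%nat -> Rabs (z i) <= 1) -> peval z K = 1 -> 0 < peval z F) ->
  exists d, 0 < d /\ forall z, (forall i, (i < k)%nat -> Rabs (z i) <= 1) ->
    peval z K = 1 -> d <= peval z F.
Proof.
  intros HF HK H.
  destruct (peval_lipschitz k F HF 1 ltac:(lra)) as [LF [HLF GF]].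
  destruct (peval_lipschitz k K HK 1 ltac:(lra)) as [LK [HLK GK]].
  set (lo := to_Tn k (fun _ => -1)). set (hi := to_Tn k (fun _ => 1)).
  assert (Gauge : forall t, exists d : posreal, Compactness.bounded_n k lo hi t ->
    forall z, (forall i, (i < k)%nat -> Rabs (z i) <= 1) ->
      (forall i, (i < k)%nat -> Rabs (z i - of_Tn k t i) < d) ->
      peval z K = 1 -> d <= peval z F).
  { intros t. set (x := of_Tn k t).
    destruct (classic (Compactness.bounded_n k lo hi t)) as [Hb|Hb].
    2:{ exists (mkposreal 1 Rlt_0_1). tauto. }
    assert (Hx : forall i, (i < k)%nat -> Rabs (x i) <= 1).
    { intros i Hi. apply Rabs_le.
      apply (bounded_of_Tn k (fun _ => -1) (fun _ => 1) t Hb i Hi). }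
    destruct (Req_dec (peval x K) 1) as [HK1|HK1].
    - pose proof (H x Hx HK1) as Hpos.
      (* As [F(x) = 2 d (LF + 1)] and [F] varies by at most [LF d] within distance [d], the value
         nearby is at least [d]. *)
      assert (Hd : 0 < peval x F / (2 * (LF + 1))) by (apply Rdiv_lt_0_compat; lra).
      exists (mkposreal _ Hd). intros _ z Hz Hc _. cbn [pos] in *.
      set (d := peval x F / (2 * (LF + 1))) in *.
      destruct (GF z x d ltac:(lra) Hz Hx) as [_ [_ G]].
      { intros i Hi. apply Rlt_le, Hc; auto. }
      assert (d * (LF + 1) = peval x F / 2) by (unfold d; field; lra).
      pose proof (Rle_abs (- (peval z F - peval x F))). rewrite Rabs_Ropp in H1. nra.
    (* Off the level set the radius is small enough that [K] avoids the value 1 nearby, so the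
       condition holds vacuously. *)
    - assert (Hd : 0 < Rabs (peval x K - 1) / (LK + 1)).
      { apply Rdiv_lt_0_compat; [apply Rabs_pos_lt; lra|lra]. }
      exists (mkposreal _ Hd). intros _ z Hz Hc Hz1. cbn [pos] in *. exfalso.
      set (d := Rabs (peval x K - 1) / (LK + 1)) in *.
      destruct (GK z x d ltac:(lra) Hz Hx) as [_ [_ G]].
      { intros i Hi. apply Rlt_le, Hc; auto. }
      assert (d * (LK + 1) = Rabs (peval x K - 1)) by (unfold d; field; lra).
      rewrite Hz1, Rabs_minus_sym in G. nra. }
  set (delta := fun t => proj1_sig (constructive_indefinite_description _ (Gauge t))).
  destruct (Compactness.compactness_value k lo hi delta) as [d Hd].
  exists d. split; [apply cond_pos|]. intros z Hz Hz1.
  (* The compactness theorem gives its tag under a double negation. *)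
  apply NNPP. intros Hn. apply (Hd (to_Tn k z)).
  { apply bounded_to_Tn. intros i Hi. specialize (Hz i Hi).
    pose proof (Rle_abs (z i)). pose proof (Rle_abs (- z i)). rewrite Rabs_Ropp in *. lra. }
  intros [t [Hb [Hc Hle]]]. apply Hn.
  pose proof (proj2_sig (constructive_indefinite_description _ (Gauge t)) Hb z Hz) as G.
  fold (delta t) in G. eapply Rle_trans; [exact Hle|]. apply G; auto.
  intros i Hi. rewrite <- (of_to_Tn k z i Hi). now apply close_of_Tn.
Qed.

(** * Lower bounds for the Hessian form *)

Lemma qform_vec_scal n a c y : qform n a (fun i => c * y i) = c * c * qform n a y.
Proof.
  unfold qform. rewrite <- rsum_scal. apply rsum_ext; intros.
  rewrite <- rsum_scal. apply rsum_ext; intros. ring.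
Qed.

(** The point [(x, y)] in the variable layout of [hess_form]. *)
Definition hjoin (n : nat) (x y : nat -> R) : nat -> R :=
  fun i => if Nat.ltb i n then x i else y (i - n)%nat.

Lemma hjoin_l n x y i : (i < n)%nat -> hjoin n x y i = x i.
Proof. intros H. unfold hjoin. now rewrite (proj2 (Nat.ltb_lt _ _) H). Qed.

Lemma hjoin_r n x y i : hjoin n x y (n + i)%nat = y i.
Proof.
  unfold hjoin. rewrite (proj2 (Nat.ltb_ge _ _)) by lia. f_equal; lia.
Qed.

Lemma vars_lt_hess n f : vars_lt n f -> vars_lt (n + n) (hess_form n f).
Proof. intros H. apply (vars_lt_biform n). intros; now do 2 apply vars_lt_pderiv. Qed.

Lemma peval_hess_form_split n f z :
  peval z (hess_form n f) = hess n f z (fun i => z (n + i)%nat).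
Proof. exact (peval_biform n (fun i j => pderiv j (pderiv i f)) z). Qed.

Lemma peval_hess_form n f x y : vars_lt n f ->
  peval (hjoin n x y) (hess_form n f) = hess n f x y.
Proof.
  intros Hf. rewrite peval_hess_form_split. apply qform_ext.
  - intros. apply (peval_ext n); [now do 2 apply vars_lt_pderiv|]. intros; now apply hjoin_l.
  - intros; apply hjoin_r.
Qed.

Lemma qform_zero n a y : nrm2 n y = 0 -> qform n a y = 0.
Proof.
  intros Hy. rewrite (qform_ext n a a y (fun i => 0 * y i)); auto.
  - rewrite qform_vec_scal. ring.
  - intros i Hi. pose proof (nrm2_coord n y i Hi). nra.
Qed.

(** Positivity on pairs of unit vectors is uniform by compactness; homogeneity in [x] and in [y]
    carries the bound to all pairs. *)
Lemma hess_lower_bound n m f : vars_lt n f ->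
  (forall t x y, t <> 0 -> hess n f (fun l => t * x l) y = (t * t) ^ m * hess n f x y) ->
  (forall x, nonzero_vec n x -> hessian_pd n f x) ->
  exists delta, 0 < delta /\ forall x y, nonzero_vec n x ->
    delta * nrm2 n x ^ m * nrm2 n y <= hess n f x y.
Proof.
  intros Hv Hhom Hpd.
  set (Y := psum n (fun i => PMul (PVar (n + i)) (PVar (n + i)))).
  assert (EY : forall z, peval z Y = nrm2 n (fun i => z (n + i)%nat)).
  { intros z. unfold Y. now rewrite peval_psum. }
  (* The single equation [|x|^2 |y|^2 = 1] admits all pairs of unit vectors and forces [x] and [y]
     to be nonzero. *)
  destruct (compact_lower_bound (n + n) (hess_form n f) (PMul (sumsq n) Y)) as [d [Hd H]].
  - now apply vars_lt_hess.
  - split; [apply vars_lt_mono with n; [lia|apply vars_lt_sumsq]|].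
    apply vars_lt_psum; simpl; intros; lia.
  - intros z _ Hz. cbn [peval] in Hz. rewrite peval_sumsq, EY in Hz.
    pose proof (nrm2_ge0 n z). pose proof (nrm2_ge0 n (fun i => z (n + i)%nat)).
    rewrite peval_hess_form_split. apply Hpd; apply nrm2_pos_inv; nra.
  - exists d. split; auto. intros x y Hx%nrm2_pos.
    pose proof (nrm2_ge0 n y) as Hy.
    destruct (Req_dec (nrm2 n y) 0) as [Hy0|Hy0].
    { unfold hess. rewrite qform_zero, Hy0 by auto. lra. }
    assert (Hyp : 0 < nrm2 n y) by lra. clear Hy Hy0.
    assert (Norm : forall v, 0 < nrm2 n v -> exists c, c <> 0 /\ c * c = nrm2 n v /\
              nrm2 n (fun i => / c * v i) = 1).
    { intros v Hv0. exists (sqrt (nrm2 n v)).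
      pose proof (sqrt_lt_R0 _ Hv0). pose proof (sqrt_sqrt _ (Rlt_le _ _ Hv0)) as S.
      set (c := sqrt (nrm2 n v)) in *.
      repeat split; auto; [lra|]. rewrite nrm2_scal, <- S. field. lra. }
    destruct (Norm x Hx) as [a [Ha [Ha2 Hxa]]]. destruct (Norm y Hyp) as [b [Hb [Hb2 Hyb]]].
    set (x' := fun i => / a * x i) in *. set (y' := fun i => / b * y i) in *.
    assert (Ex : x = fun i => a * x' i).
    { apply functional_extensionality; intros i. unfold x'. field; auto. }
    assert (Ey : y = fun i => b * y' i).
    { apply functional_extensionality; intros i. unfold y'. field; auto. }
    assert (Key : d <= hess n f x' y').
    { rewrite <- peval_hess_form by auto. apply H.
      - assert (Unit : forall v i, nrm2 n v = 1 -> (i < n)%nat -> Rabs (v i) <= 1).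
        { intros v i Hv1 Hi. pose proof (nrm2_coord n v i Hi). apply Rabs_le. nra. }
        intros i Hi. destruct (le_lt_dec n i) as [Hge|Hlt].
        + replace i with (n + (i - n))%nat by lia. rewrite hjoin_r. apply Unit; auto; lia.
        + rewrite hjoin_l by auto. apply Unit; auto.
      - cbn [peval]. rewrite peval_sumsq, EY.
        replace (nrm2 n (hjoin n x' y')) with (nrm2 n x').
        2:{ apply rsum_ext; intros; now rewrite hjoin_l. }
        replace (nrm2 n (fun i => hjoin n x' y' (n + i)%nat)) with (nrm2 n y').
        2:{ apply rsum_ext; intros; now rewrite hjoin_r. }
        rewrite Hxa, Hyb; ring. }
    rewrite Ex at 2. rewrite Hhom by auto. rewrite Ey at 2. unfold hess at 1.
    rewrite qform_vec_scal, Hb2, Ha2. fold (hess n f x' y').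
    pose proof (pow_lt _ m Hx).
    replace (nrm2 n x ^ m * (nrm2 n y * hess n f x' y'))
      with (hess n f x' y' * nrm2 n x ^ m * nrm2 n y) by ring.
    apply Rmult_le_compat_r; [lra|]. apply Rmult_le_compat_r; lra.
Qed.

(** Only [x = 0] is new; there the inequality follows by continuity from the points
    [(tau, ..., tau)], which are nonzero as [n >= 1]. *)
Lemma hess_ge0_closure n g : (1 <= n)%nat -> vars_lt n g ->
  (forall x y, nonzero_vec n x -> 0 <= hess n g x y) ->
  forall x y, 0 <= hess n g x y.
Proof.
  intros Hn Hv H x y.
  destruct (Req_dec (nrm2 n x) 0) as [Hx|Hx].
  2:{ apply H, nrm2_pos_inv. pose proof (nrm2_ge0 n x). lra. }
  assert (Hx0 : forall i, (i < n)%nat -> x i = 0).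
  { intros i Hi. pose proof (nrm2_coord n x i Hi). nra. }
  apply Rnot_lt_le. intros Hneg.
  pose proof (nrm2_ge0 n y) as Hy.
  destruct (peval_lipschitz (n + n) (hess_form n g) (vars_lt_hess n g Hv) (1 + nrm2 n y)
    ltac:(lra)) as [L [HL G]].
  set (a := - hess n g x y) in *. assert (Ha : 0 < a) by (unfold a; lra).
  (* This makes [L * tau < a], so the form cannot rise from [- a] to 0 within distance [tau]; also
     [tau < 1] keeps the points in the Lipschitz box. *)
  set (tau := a / (a + L + 1)).
  assert (Ht : tau * (a + L + 1) = a) by (unfold tau; field; lra).
  assert (Htp : 0 < tau) by (apply Rdiv_lt_0_compat; lra).
  assert (Ht1 : tau < 1) by nra.
  set (x' := fun _ : nat => tau).
  assert (Bd : forall v i, (forall i, (i < n)%nat -> 0 <= v i <= 1) -> (i < n + n)%nat ->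
    Rabs (hjoin n v y i) <= 1 + nrm2 n y).
  { intros v i Hv1 Hi. destruct (le_lt_dec n i) as [Hge|Hlt].
    - replace i with (n + (i - n))%nat by lia. rewrite hjoin_r.
      pose proof (nrm2_coord n y (i - n) ltac:(lia)). apply Rabs_le. nra.
    - rewrite hjoin_l by auto. specialize (Hv1 i Hlt). apply Rabs_le; lra. }
  destruct (G (hjoin n x' y) (hjoin n x y) tau) as [_ [_ D]]; [lra|..].
  - intros i Hi. apply Bd; auto. intros; unfold x'; lra.
  - intros i Hi. apply Bd; auto. intros l Hl. rewrite Hx0 by auto; lra.
  - intros i Hi. destruct (le_lt_dec n i) as [Hge|Hlt].
    + replace i with (n + (i - n))%nat by lia. rewrite !hjoin_r, Rminus_diag, Rabs_R0. lra.
    + rewrite !hjoin_l, Hx0 by auto. unfold x'. rewrite Rminus_0_r, Rabs_pos_eq; lra.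
  - rewrite !peval_hess_form in D by auto.
    assert (0 <= hess n g x' y).
    { apply H. exists O. split; [lia|]. unfold x'. lra. }
    pose proof (Rle_abs (hess n g x' y - hess n g x y)).
    fold a in Hneg. replace (hess n g x y) with (- a) in * by (unfold a; ring). nra.
Qed.

(** * Positive definite Hessians and [r]-sos-convexity after subtracting [c |x|^d] *)

Theorem theorem7 (n d : nat) (f : mpoly)
  (hn : (2 <= n)%nat) (hd : (2 <= d)%nat) (hdeven : Nat.Even d)
  (hf : is_form n d f) :
  (forall x : nat -> R, nonzero_vec n x -> hessian_pd n f x) <->
  (exists (c : R) (r : nat), 0 < c /\
     r_sos_convex n r (PAdd f (PMul (PConst (- c)) (ppow (sumsq n) (d / 2))))).
Proof.
  destruct hf as [Hv Hf].
  (* Write [d = 2 (m + 1)]; the second derivatives then have degree [2 m], whence the exponent [m]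
     in [(t * t) ^ m]. *)
  destruct hdeven as [[|m] Hd]; [lia|].
  replace (d / 2)%nat with (S m) by (rewrite Hd, Nat.mul_comm, Nat.div_mul; lia).
  set (g := fun c => PAdd f (PMul (PConst (- c)) (ppow (sumsq n) (S m)))).
  assert (Hg : forall c x y,
    hess n (g c) x y = hess n f x y - c * hess n (ppow (sumsq n) (S m)) x y).
  { intros c x y. unfold g. rewrite hess_add, hess_scal. ring. }
  assert (Hgv : forall c, vars_lt n (g c)).
  { intros c. split; auto. split; [exact I|]. apply vars_lt_ppow, vars_lt_sumsq. }
  assert (Hhom : forall p, (forall t x, peval (fun i => t * x i) p = t ^ d * peval x p) ->
    forall t x y, t <> 0 -> hess n p (fun l => t * x l) y = (t * t) ^ m * hess n p x y).
  { intros p Hp t x y Ht. unfold hess. rewrite <- qform_scal. apply qform_ext; auto.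
    intros i j Hi Hj. replace ((t * t) ^ m) with (t ^ (2 * m)).
    2:{ rewrite pow_mult. f_equal. ring. }
    apply pderiv_homogeneous; auto. intros t' x' Ht'. apply pderiv_homogeneous; auto.
    intros t'' x'' _. rewrite Hp. do 2 f_equal. lia. }
  split.
  - intros Hpd.
    destruct (hess_lower_bound n m f Hv (Hhom f Hf) Hpd) as [delta [Hdelta Hlow]].
    set (A0 := 2 * INR (S m) + 4 * INR (S m) * INR m).
    assert (HA : 0 < A0).
    { unfold A0. pose proof (pos_INR m). rewrite S_INR. nra. }
    (* [A0] bounds the Hessian form of [|x|^d] relative to [|x|^(2m) |y|^2], so this [c] spends at
       most half of [delta]. *)
    set (c := delta / (2 * A0)).
    assert (Hc : 0 < c) by (apply Rdiv_lt_0_compat; lra).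
    assert (Hpos : forall x y, nonzero_vec n x ->
      delta / 2 * nrm2 n x ^ m * nrm2 n y <= hess n (g c) x y).
    { intros x y Hx. rewrite Hg. specialize (Hlow x y Hx).
      pose proof (hess_sumsq_pow_le n m x y) as Hup. fold A0 in Hup.
      apply (Rmult_le_compat_l c) in Hup; [|lra].
      replace (c * (A0 * nrm2 n x ^ m * nrm2 n y))
        with (delta / 2 * nrm2 n x ^ m * nrm2 n y) in Hup by (unfold c; field; lra).
      lra. }
    destruct (positive_biform_sos n m (fun i j => pderiv j (pderiv i (g c))) (delta / 2))
      as [r Hr]; [lia|lra| | | | |].
    + intros; now do 2 apply vars_lt_pderiv.
    + apply (Hhom (g c)). intros t x. unfold g. cbn [peval].
      rewrite Hf, !peval_ppow, !peval_sumsq, nrm2_scal, Rpow_mult_distr.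
      replace ((t * t) ^ S m) with (t ^ d); [ring|].
      rewrite Hd, pow_mult. f_equal. ring.
    + apply (hess_ge0_closure n (g c)); [lia|auto|].
      intros x y Hx. eapply Rle_trans; [|apply Hpos; auto].
      pose proof (pow_le _ m (nrm2_ge0 n x)). pose proof (nrm2_ge0 n y).
      repeat apply Rmult_le_pos; lra.
    + exact Hpos.
    + exists c, r. split; auto.
  (* Conversely, dividing by [|x|^(2r) > 0] gives a nonnegative Hessian form of [g c]; adding back
     the positive one of [c |x|^d] makes it strict. *)
  - intros [c [r [Hc [qs [_ Hsos]]]]] x Hx y Hy.
    change (0 < hess n f x y).
    pose proof (hess_sumsq_pow_pos n m x y Hx Hy) as Hp.
    specialize (Hsos (hjoin n x y)). fold (g c) in Hsos. cbn [peval] in Hsos.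
    rewrite peval_hess_form, peval_ppow, peval_sumsq, Hg in Hsos by auto.
    replace (nrm2 n (hjoin n x y)) with (nrm2 n x) in Hsos.
    2:{ apply rsum_ext; intros; now rewrite hjoin_l. }
    pose proof (lsum_ge0 (fun q => peval (hjoin n x y) q ^ 2) qs
      (fun q => pow2_ge_0 _)) as Hge.
    unfold lsum in Hge. rewrite <- Hsos in Hge.
    pose proof (pow_lt _ r (nrm2_pos n x Hx)) as Hs.
    assert (0 <= hess n f x y - c * hess n (ppow (sumsq n) (S m)) x y).
    { apply Rmult_le_reg_r with (nrm2 n x ^ r); lra. }
    nra.
Qed.
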